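(* (1) For every integer $n\ge 0$, $$\lim_{t\to\infty}\frac{\big|\{\gamma\in\mathcal{E}_{2n}^{1} : |\gamma|=4t\}\big|}{t^{2n}}=\frac{1}{(2n)!}.$$ (2) For every integer $D\ge 2$, $$\lim_{t\to\infty}\frac{\big|\{\gamma\in\mathcal{E}_{2}^{D} : |\gamma|=4t\}\big|}{t\,\alpha_D^{t}}=\frac{d_D^{2}}{\alpha_D^{D}(\alpha_D-1)},$$ where $\alpha_D$ is the unique positive root of $z^D-z^{D-1}-\dots-z-1$ and $d_D=\dfrac{\alpha_D-1}{2+(D+1)(\alpha_D-2)}$. In both limits $t$ ranges over the positive integers.
   Context: Let $G=\mathbb{Z}_2*\mathbb{Z}_3$ with generators $a$ (of order two, generating the factor $\mathbb{Z}_2$) and $b$ (of order three, generating the factor $\mathbb{Z}_3$). $G$ is identified with $PSL(2,\mathbb{Z})$ via $a\mapsto A=\begin{pmatrix}0&-1\\1&0\end{pmatrix}$, $b\mapsto B=\begin{pmatrix}1&-1\\1&0\end{pmatrix}$. The modular surface is $S=\mathbb{H}/PSL(2,\mathbb{Z})$. A closed geodesic on $S$ corresponds to a conjugacy class of hyperbolic elements of $PSL(2,\mathbb{Z})$. Reciprocal geodesics: a reciprocal geodesic $\gamma$ on $S$ is a closed geodesic that begins and ends at the order two cone point of $S$; equivalently, it is a conjugacy class in $PSL(2,\mathbb{Z})$ of a hyperbolic element whose axis passes through a fixed point of an order two element. Reciprocal geodesics need not be primitive. Every reciprocal geodesic has a representative in its conjugacy class of the normal form $$ab^{\epsilon_1}\cdots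 ab^{\epsilon_t}\,ab^{-\epsilon_t}\cdots ab^{-\epsilon_1},\qquad \epsilon_i\in\{1,-1\},\ t\ge 1,$$ and every word of this form represents a reciprocal geodesic. Word length: $|\gamma|$ is the minimal word length, with respect to the generators $a,b,b^{-1}$ of $G$, among the elements of the conjugacy class corresponding to $\gamma$. For a reciprocal geodesic with normal form $ab^{\epsilon_1}\cdots ab^{\epsilon_t}\,ab^{-\epsilon_t}\cdots ab^{-\epsilon_1}$, $|\gamma|=4t$. Cusp excursions: the run sequence of a finite sequence of signs is the sequence of lengths of its maximal blocks of consecutive equal entries (for example $(1,1,1,-1,1,-1,-1,1)$ has run sequence $(3,1,1,2,1)$). For integers $D\ge 1$ and $n\ge 0$, $\mathcal{E}_{2n}^{D}$ is the set of reciprocal geodesics $\gamma$ with exactly $2n$ cusp excursions of depth greater than $D$, i.e. such that the sign sequence $(\epsilon_1,\dots,\epsilon_t,-\epsilon_t,\dots,-\epsilon_1)$ of its normal form has a run sequence with exactly $2n$ parts of size at least $D+1$. *)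

(* Defs.v *)
From HB Require Import structures.
From mathcomp Require Import all_boot all_order all_algebra.
From mathcomp Require Import finmap.
From mathcomp Require Import all_classical all_reals all_analysis.
From mathcomp Require Import complex.

Set Implicit Arguments.
Unset Strict Implicit.
Unset Printing Implicit Defensive.

Import Order.TTheory GRing.Theory Num.Theory.
Import numFieldNormedType.Exports.

Local Open Scope classical_set_scope.
Local Open Scope ring_scope.

(* Elements of PSL(2,Z) are represented by matrices of determinant 1, taken up
   to sign; subsets of PSL(2,Z) are sets of such matrices stable under -1. *)

Definition psl_eq (M N : 'M[int]_2) : Prop := M = N \/ M = - N.

Definition psl_class (M : 'M[int]_2) : set 'M[int]_2 :=
  [set N | exists2 P : 'M[int]_2, \det P = 1 & psl_eq N (P * M * P^-1)].

Definition mx2 (p q r s : int) : 'M[int]_2 :=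
  \matrix_(i, j) if i == 0 then (if j == 0 then p else q)
                 else (if j == 0 then r else s).

Definition genA : 'M[int]_2 := mx2 0 (-1) 1 0.
Definition genB : 'M[int]_2 := mx2 1 (-1) 1 0.

Definition hyperbolic (M : 'M[int]_2) : Prop := 2 < `|\tr M|.

Definition order_two (M : 'M[int]_2) : Prop :=
  ~ psl_eq M 1 /\ psl_eq (M * M) 1.

(* The fractional linear map of M fixes the finite point z. The condition on the
   denominator is needed because x / 0 = 0 in MathComp fields. *)
Definition moebius_fixes (F : fieldType) (M : 'M[int]_2) (z : F) : Prop :=
  let num := (M 0 0)%:~R * z + (M 0 1)%:~R in
  let den := (M 1 0)%:~R * z + (M 1 1)%:~R in
  den != 0 /\ num / den = z.

(* The hyperbolic line of the upper half-plane with ends x1 and x2: the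
   Euclidean half-circle with diameter [x1, x2]. *)
Definition half_circle (R : realType) (x1 x2 : R) : set (complex R) :=
  [set z | 0 < complex.Im z /\
     (complex.Re z - (x1 + x2) / 2) ^+ 2 + complex.Im z ^+ 2
       = ((x1 - x2) / 2) ^+ 2].

(* A hyperbolic integral matrix has nonzero lower-left entry (otherwise its
   trace would be 2 or -2), so its two fixed points are never infinity. *)
Definition axis (R : realType) (M : 'M[int]_2) : set (complex R) :=
  [set z | exists x1 x2 : R,
     [/\ x1 != x2, moebius_fixes M x1, moebius_fixes M x2
       & half_circle x1 x2 z]].

Definition reciprocal_geodesic (R : realType) (gamma : set 'M[int]_2) : Prop :=
  exists M : 'M[int]_2,
    [/\ \det M = 1, hyperbolic M, gamma = psl_class M
      & exists (E : 'M[int]_2) (z : complex R),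
          [/\ \det E = 1, order_two E, 0 < complex.Im z, moebius_fixes E z
            & axis M z]].

Definition is_min (S : set nat) (n : nat) : Prop :=
  S n /\ forall m, S m -> (n <= m)%N.

Definition word_length (M : 'M[int]_2) (n : nat) : Prop :=
  is_min [set k | exists w : seq 'M[int]_2,
            [/\ {subset w <= [:: genA; genB; genB^-1]},
                psl_eq M (\prod_(g <- w) g) & size w = k]] n.

Definition class_length (gamma : set 'M[int]_2) (n : nat) : Prop :=
  is_min [set k | exists2 M, gamma M & word_length M k] n.

(* (e_1, ..., e_t) |-> (e_1, ..., e_t, - e_t, ..., - e_1) *)
Definition antipalindrome (e : seq int) : seq int :=
  e ++ rev [seq - x | x <- e].

Definition is_sign_seq (e : seq int) : Prop :=
  e <> [::] /\ {subset e <= [:: 1; -1]}.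

Definition normal_form (e : seq int) : 'M[int]_2 :=
  \prod_(x <- antipalindrome e) (genA * genB ^ x).

Fixpoint run_seq (T : eqType) (s : seq T) : seq nat :=
  if s is x :: s' then
    if ohead s' == Some x then incr_nth (run_seq s') 0
    else 1%N :: run_seq s'
  else [::].

Example run_seq_example :
  run_seq [:: 1; 1; 1; -1; 1; -1; -1; 1 : int] = [:: 3; 1; 1; 2; 1]%N.
Proof. by []. Qed.

Definition excursions (D : nat) (e : seq int) : nat :=
  count (fun r => D < r)%N (run_seq (antipalindrome e)).

(* Two normal forms of the same class differ by a cyclic shift exchanging the
   two halves of the sign sequence, so the number of excursions does not depend
   on the normal form chosen. *)
Definition excursion_set (R : realType) (D m : nat) : set (set 'M[int]_2) :=
  [set gamma | reciprocal_geodesic R gamma /\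
     exists e : seq int,
       [/\ is_sign_seq e, gamma (normal_form e) & excursions D e = m]].

(* fset_set sends an infinite set to fset0; the sets counted here are finite,
   as there are finitely many words of length 4t. *)
Definition excursion_count (R : realType) (D m t : nat) : nat :=
  #|` fset_set [set gamma | excursion_set R D m gamma
                            /\ class_length gamma (4 * t)%N]|.

Definition alpha_poly (R : realType) (D : nat) : {poly R} :=
  'X^D - \sum_(i < D) 'X^i.

Definition is_alpha (R : realType) (D : nat) (alpha : R) : Prop :=
  unique (fun z : R => 0 < z /\ root (alpha_poly R D) z) alpha.

Definition d_coef (R : realType) (D : nat) (alpha : R) : R :=
  (alpha - 1) / (2 + (D%:R + 1) * (alpha - 2)).

(* Main.v *)
Require Import Defs.
From HB Require Import structures.
From mathcomp Require Import all_boot all_order all_algebra.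
From mathcomp Require Import finmap.
From mathcomp Require Import all_classical all_reals all_analysis.
From mathcomp Require Import complex.
From mathcomp Require Import zify ring lra.

(* A normal form is, up to sign and conjugation by the reflection diag(1, -1),
   the product of the matrices L = [[1,0],[1,1]] and U = [[1,1],[0,1]] spelled by
   its sign sequence. These generate freely the monoid of nonnegative matrices of
   determinant 1. If P conjugates the hyperbolic word matrix X to the word matrix
   X', then so does P X^n, which for n large is plus or minus a nonnegative
   matrix, i.e. a word q with s' q = q s: conjugate words are cyclic rotations
   of each other. Applied to cyclically reduced words in a, b this also yields
   the class lengths.

   The least period p of an antipalindrome is even, and exactly two of its
   rotations, by 0 and p / 2, are antipalindromes, so the number of geodesics of length 4t with
   2n deep excursions is half the number of sign sequences of length t with n
   runs of length > D, i.e. the number c_n(t) of compositions of t with n parts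
   > D. Prepending a sign gives
     c_n(t+1) = 2 c_n(t) - c_n(t-D) + c_{n-1}(t-D).
   For D = 1 this is solved by the binomial coefficients C(t, 2n). In general,
   with beta = alpha^-(D+1), the normalized sequences u = c_0 / alpha^t and
   h = c_1 / alpha^t satisfy 1 + beta = 2 / alpha, beta D < 1,
     u(t+1) - u(t) = beta (u(t) - u(t-D)),
     h(t+1) - h(t) = beta (h(t) - h(t-D)) + beta u(t-D).
   So u and the increments of h both satisfy x(k+D) = beta (x(k) + ... +
   x(k+D-1)) + y(k) with y convergent, which forces convergence to
   lim y / (1 - beta D); the limit of h(t) / t follows by Cesaro. *)

Set Implicit Arguments.
Unset Strict Implicit.
Unset Printing Implicit Defensive.

Import Order.TTheory GRing.Theory Num.Theory.
Import numFieldNormedType.Exports.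

Local Open Scope classical_set_scope.
Local Open Scope ring_scope.

(** * Nonnegative matrices of determinant 1 *)

Lemma mx2_00 p q r s : mx2 p q r s 0 0 = p. Proof. by rewrite mxE. Qed.
Lemma mx2_01 p q r s : mx2 p q r s 0 1 = q. Proof. by rewrite mxE. Qed.
Lemma mx2_10 p q r s : mx2 p q r s 1 0 = r. Proof. by rewrite mxE. Qed.
Lemma mx2_11 p q r s : mx2 p q r s 1 1 = s. Proof. by rewrite mxE. Qed.
Definition mx2_ij := (mx2_00, mx2_01, mx2_10, mx2_11).

Lemma ord2P (P : 'I_2 -> Prop) : P 0 -> P 1 -> forall i, P i.
Proof.
move=> P0 P1 [[|[|//]] i].
- by have -> : Ordinal i = 0 by exact: val_inj.
- by have -> : Ordinal i = 1 by exact: val_inj.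
Qed.

Lemma mx2_eta (M : 'M[int]_2) : M = mx2 (M 0 0) (M 0 1) (M 1 0) (M 1 1).
Proof. by apply/matrixP; apply: ord2P; apply: ord2P; rewrite mx2_ij. Qed.

Lemma mx2_inj p q r s p' q' r' s' :
  mx2 p q r s = mx2 p' q' r' s' -> [/\ p = p', q = q', r = r' & s = s'].
Proof.
move=> e; split.
- by have := congr1 (fun M : 'M[int]_2 => M 0 0) e; rewrite !mx2_ij.
- by have := congr1 (fun M : 'M[int]_2 => M 0 1) e; rewrite !mx2_ij.
- by have := congr1 (fun M : 'M[int]_2 => M 1 0) e; rewrite !mx2_ij.
- by have := congr1 (fun M : 'M[int]_2 => M 1 1) e; rewrite !mx2_ij.
Qed.

Lemma mx2_mulE (M N : 'M[int]_2) i j :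
  (M * N) i j = M i 0 * N 0 j + M i 1 * N 1 j.
Proof.
rewrite -mulmxE mxE big_ord_recl big_ord1.
by congr (M i _ * N _ j + M i _ * N _ j); exact: val_inj.
Qed.

Lemma mx2_mul p q r s p' q' r' s' :
  mx2 p q r s * mx2 p' q' r' s' =
  mx2 (p * p' + q * r') (p * q' + q * s') (r * p' + s * r') (r * q' + s * s').
Proof. by rewrite [LHS]mx2_eta !mx2_mulE !mx2_ij. Qed.

Lemma mx2_opp p q r s : - mx2 p q r s = mx2 (- p) (- q) (- r) (- s).
Proof. by rewrite [LHS]mx2_eta !mxE !eqxx. Qed.

Lemma mx2_1 : 1 = mx2 1 0 0 1.
Proof. by rewrite [LHS]mx2_eta !mxE. Qed.

Lemma mx2_tr (M : 'M[int]_2) : \tr M = M 0 0 + M 1 1.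
Proof.
rewrite /mxtrace big_ord_recl big_ord1.
by congr (M _ _ + M _ _); exact: val_inj.
Qed.

Lemma mx2_det (M : 'M[int]_2) : \det M = M 0 0 * M 1 1 - M 0 1 * M 1 0.
Proof.
rewrite (expand_det_row _ 0) big_ord_recl big_ord1 /cofactor !det_mx11 !mxE /=.
rewrite ?expr0 ?mul1r ?expr1 ?mulN1r ?mulrN.
by congr (M _ _ * M _ _ - M _ _ * M _ _); exact: val_inj.
Qed.

Lemma det1_unit (P : 'M[int]_2) : \det P = 1 -> P \is a GRing.unit.
Proof. by rewrite -[_ \is a _]/(P \in unitmx) unitmxE => ->; exact: unitr1. Qed.

Lemma det_mulr (M N : 'M[int]_2) : \det (M * N) = \det M * \det N.
Proof. by rewrite -mulmxE det_mulmx. Qed.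

Lemma det1_inv (P : 'M[int]_2) : \det P = 1 -> \det P^-1 = 1.
Proof. by move=> P1; rewrite detV P1 invr1. Qed.

Lemma tr_conj (P M : 'M[int]_2) : \det P = 1 -> \tr (P * M * P^-1) = \tr M.
Proof.
move=> P1; rewrite -mulmxE -mulmxA mxtrace_mulC !mulmxE.
by rewrite mulrVK // det1_unit.
Qed.

(* The letters L (true) and U (false) freely generate the monoid of
   nonnegative integral matrices of determinant 1. *)
Definition letter_mx (b : bool) : 'M[int]_2 :=
  if b then mx2 1 0 1 1 else mx2 1 1 0 1.

Definition word_mx (s : seq bool) : 'M[int]_2 := \prod_(b <- s) letter_mx b.

Lemma word_mx_cons b s : word_mx (b :: s) = letter_mx b * word_mx s.
Proof. exact: big_cons. Qed.

Lemma word_mx_cat s s' : word_mx (s ++ s') = word_mx s * word_mx s'.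
Proof. exact: big_cat. Qed.

Lemma det_letter b : \det (letter_mx b) = 1.
Proof. by rewrite mx2_det; case: b; rewrite !mx2_ij. Qed.

Lemma det_word s : \det (word_mx s) = 1.
Proof.
elim: s => [|b s ih]; first by rewrite /word_mx big_nil det1.
by rewrite word_mx_cons det_mulr ih det_letter.
Qed.

Definition nonneg_mx (M : 'M[int]_2) :=
  [/\ 0 <= M 0 0, 0 <= M 0 1, 0 <= M 1 0 & 0 <= M 1 1].

Lemma letter_mulE b (M : 'M[int]_2) :
  letter_mx b * M =
  if b then mx2 (M 0 0) (M 0 1) (M 0 0 + M 1 0) (M 0 1 + M 1 1)
  else mx2 (M 0 0 + M 1 0) (M 0 1 + M 1 1) (M 1 0) (M 1 1).
Proof.
by case: b; rewrite {1}[M]mx2_eta mx2_mul !mul1r !mul0r ?addr0 ?add0r.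
Qed.

Lemma mul_letterE b (M : 'M[int]_2) i :
  (M * letter_mx b) i 0 = M i 0 + b%:Z * M i 1 /\
  (M * letter_mx b) i 1 = M i 1 + (~~ b)%:Z * M i 0.
Proof. by rewrite !mx2_mulE; case: b; rewrite !mx2_ij /=; lia. Qed.

Lemma word_nonneg s :
  [/\ 1 <= word_mx s 0 0, 0 <= word_mx s 0 1,
      0 <= word_mx s 1 0 & 1 <= word_mx s 1 1].
Proof.
elim: s => [|b s]; first by rewrite /word_mx big_nil mx2_1 !mx2_ij.
rewrite word_mx_cons letter_mulE; case: b; rewrite !mx2_ij => -[????].
  by split; lia.
by split; lia.
Qed.

Lemma word_offdiag b s : b \in s ->
  1 <= if b then word_mx s 1 0 else word_mx s 0 1.
Proof.
elim: s => // c s ih; rewrite inE word_mx_cons letter_mulE.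
have [????] := word_nonneg s.
case: b c ih => -[] /=; rewrite !mx2_ij => ih; try lia.
all: by move=> /ih; lia.
Qed.

(** With both letters present the off-diagonal entries are at least 1, so the determinant forces the
    product of the diagonal entries to be at least 2. *)
Lemma word_tr_gt2 s : true \in s -> false \in s -> 2 < \tr (word_mx s).
Proof.
move=> /word_offdiag h1 /word_offdiag h0; have [????] := word_nonneg s.
have := det_word s; rewrite mx2_det mx2_tr; nia.
Qed.

Lemma word_tr_ge2 s : 2 <= \tr (word_mx s).
Proof. by have [????] := word_nonneg s; rewrite mx2_tr; lia. Qed.

Lemma word_pos s : 2 < \tr (word_mx s) ->
  [/\ 1 <= word_mx s 0 0, 1 <= word_mx s 0 1,
      1 <= word_mx s 1 0 & 1 <= word_mx s 1 1].
Proof.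
have := det_word s; have [] := word_nonneg s.
rewrite mx2_det mx2_tr; move: (word_mx s 0 0) (word_mx s 0 1)
  (word_mx s 1 0) (word_mx s 1 1) => a b c d a1 b0 c0 d1 e h.
by split=> //; nia.
Qed.

(** Euclidean descent: if one row dominates the other entrywise, subtracting it strips a letter and
    lowers the sum of the entries; otherwise the determinant forces the identity. *)
Lemma word_mx_surj (M : 'M[int]_2) :
  nonneg_mx M -> \det M = 1 -> exists s, word_mx s = M.
Proof.
move=> [a0 b0 c0 d0] detM.
have [n] := ubnP (absz (M 0 0 + M 0 1 + M 1 0 + M 1 1)).
elim: n => // n ih in M a0 b0 c0 d0 detM *; move=> leMn.
have step b (N : 'M[int]_2) : M = letter_mx b * N ->
    (0 <= N 0 0) && (0 <= N 0 1) && (0 <= N 1 0) && (0 <= N 1 1) ->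
    N 0 0 + N 0 1 + N 1 0 + N 1 1 < M 0 0 + M 0 1 + M 1 0 + M 1 1 ->
    exists s, word_mx s = M.
  move=> eM /andP[/andP[/andP[h1 h2] h3] h4] lt.
  have [//||s es] := ih N h1 h2 h3 h4.
    by rewrite -detM eM det_mulr det_letter mul1r.
    by move: leMn lt; lia.
  by exists (b :: s); rewrite word_mx_cons es.
move: detM; rewrite mx2_det.
move=> detM.
have [/andP[hac hbd]|nL] := boolP ((M 0 0 <= M 1 0) && (M 0 1 <= M 1 1)).
  apply: (step true (mx2 (M 0 0) (M 0 1) (M 1 0 - M 0 0) (M 1 1 - M 0 1))).
  - by rewrite letter_mulE !mx2_ij ![_ + (_ - _)]addrC !subrK -mx2_eta.
  - by rewrite !mx2_ij; lia.
  - by rewrite !mx2_ij; nia.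
have [/andP[hac hbd]|nU] := boolP ((M 1 0 <= M 0 0) && (M 1 1 <= M 0 1)).
  apply: (step false (mx2 (M 0 0 - M 1 0) (M 0 1 - M 1 1) (M 1 0) (M 1 1))).
  - by rewrite letter_mulE !mx2_ij !subrK -mx2_eta.
  - by rewrite !mx2_ij; lia.
  - by rewrite !mx2_ij; nia.
exists [::]; rewrite /word_mx big_nil mx2_1 [RHS]mx2_eta.
suff [-> -> -> ->] : [/\ M 0 0 = 1, M 0 1 = 0, M 1 0 = 0 & M 1 1 = 1] by [].
move: (M 0 0) (M 0 1) (M 1 0) (M 1 1) a0 b0 c0 d0 detM nL nU => a b c d.
move=> a0 b0 c0 d0 e nL nU.
(* The opposite crossing, [a < c] and [d < b], would make the determinant negative. Then
   [(c + 1) * (b + 1) <= a * d = 1 + b * c] leaves no room for [b] or [c]. *)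
have [ac bd] : c + 1 <= a /\ b + 1 <= d.
  by have [?|?] := leP a c; have [?|?] := leP c a; have [?|?] := leP b d;
     have [?|?] := leP d b; split; nia.
have h : (c + 1) * (b + 1) <= a * d by nia.
have [-> ->] : b = 0 /\ c = 0 by lia.
by split => //; nia.
Qed.

(** The first letter can be read off: it tells which row dominates the other. Letters are
    invertible, so it can be cancelled. *)
Lemma word_mx_inj : injective word_mx.
Proof.
have unitL b : letter_mx b \is a GRing.unit by exact: det1_unit (det_letter b).
have cons_neq1 b s : word_mx (b :: s) <> 1.
  rewrite word_mx_cons letter_mulE mx2_1; have [????] := word_nonneg s.
  by case: b => /mx2_inj[]; lia.
have head b b' s s' : word_mx (b :: s) = word_mx (b' :: s') -> b = b'.
  rewrite !word_mx_cons !letter_mulE.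
  have [????] := word_nonneg s; have [????] := word_nonneg s'.
  by case: b; case: b' => // /mx2_inj[]; lia.
elim=> [|b s ih] [|b' s'] // e.
- by case: (cons_neq1 b' s'); rewrite -e /word_mx big_nil.
- by case: (cons_neq1 b s); rewrite e /word_mx big_nil.
move: (e) => /head bb'; rewrite -bb' in e *; congr (_ :: _); apply: ih.
by apply: (mulrI (unitL b)); rewrite -!word_mx_cons.
Qed.

(** * Conjugate word matrices and cyclic rotations *)

Lemma row_same_sign_stable s (P : 'M[int]_2) i : 0 <= P i 0 * P i 1 ->
  0 <= (P * word_mx s) i 0 * (P * word_mx s) i 1.
Proof.
elim: s P => [|b s ih] P h; first by rewrite /word_mx big_nil mulr1.
rewrite word_mx_cons mulrA; apply: ih.
by have [-> ->] := mul_letterE b P i; case: b => /=; nia.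
Qed.

(* If the entries of a row have opposite signs, multiplication by a letter either
   gives them the same sign or decreases the sum of their absolute values. *)
Lemma row_same_sign s (P : 'M[int]_2) i :
  (absz (P i 0%R) + absz (P i 1%R) <= size s)%N ->
  0 <= (P * word_mx s) i 0 * (P * word_mx s) i 1.
Proof.
elim: s P => [|b s ih] P.
  rewrite /= leqn0 addn_eq0 !absz_eq0 => /andP[/eqP h _].
  by rewrite /word_mx big_nil mulr1 h mul0r.
have [h _|h le] := leP 0 (P i 0 * P i 1); first exact: row_same_sign_stable.
rewrite word_mx_cons mulrA.
have [h'|h'] := leP 0 ((P * letter_mx b) i 0 * (P * letter_mx b) i 1).
  exact: row_same_sign_stable.
apply: ih; move: h'; have [-> ->] := mul_letterE b P i.
move: (P i 0) (P i 1) h le => x y h /= le.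
have [[x0 y0]|[x0 y0]] : (x < 0 /\ 0 < y) \/ (0 < x /\ y < 0) by nia.
  case: b; rewrite /= ?mul1r ?mul0r ?addr0 => h'.
    have : x + y < 0 by nia.
    by lia.
  have : 0 < y + x by nia.
    by lia.
case: b; rewrite /= ?mul1r ?mul0r ?addr0 => h'.
  have : 0 < x + y by nia.
    by lia.
have : y + x < 0 by nia.
    by lia.
Qed.

(** Copies of [s'] are peeled off the front of [q] until [q] is shorter than [s']; then
    [s' = q ++ r] and [s = r ++ q]. *)
Lemma eq_cat_rot (T : eqType) (s s' q : seq T) :
  s' ++ q = q ++ s -> exists k, s' = rot k s.
Proof.
have [n] := ubnP (size q); elim: n => // n ih in q *; move=> szq e.
have [s'0|s'0] := posnP (size s').
  have es := congr1 size e; move: es; rewrite !size_cat s'0 add0n.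
  move/eqP; rewrite -{1}[size q]addn0 eqn_add2l eq_sym size_eq0 => /eqP ->.
  by exists 0; apply/nilP; rewrite /nilp s'0.
have [le|lt] := leqP (size s') (size q).
  have eq : q = s' ++ drop (size s') q.
    have := congr1 (take (size s')) e; rewrite take_size_cat // takel_cat // => {1}->.
    by rewrite cat_take_drop.
  apply: (ih (drop (size s') q)).
    by rewrite size_drop; move: szq s'0; lia.
  move: e; rewrite {1 2}eq -catA => /eqP; rewrite eqseq_cat // eqxx /= => /eqP.
  by rewrite -eq.
have es' : s' = q ++ drop (size q) s'.
  have := congr1 (take (size q)) e; rewrite takel_cat 1?ltnW // take_size_cat //.
  by move=> {1}<-; rewrite cat_take_drop.
move: e; rewrite {1}es' -catA => /eqP; rewrite eqseq_cat // eqxx /= => /eqP <-.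
by exists (size (drop (size q) s')); rewrite rot_size_cat.
Qed.

Lemma word_mx_flatten n s : word_mx (flatten (nseq n s)) = word_mx s ^+ n.
Proof.
elim: n => [|n ih]; first by rewrite /word_mx big_nil.
by rewrite /= word_mx_cat ih exprS.
Qed.

(* The quotient of the entries of a row of Q is compared with the positive root
   of [b x^2 + (d - a) x - c]: the sign hypotheses put p / q above it and
   r / s below it, while the determinant gives p / q < r / s. *)
Lemma no_mixed_rows (a b c d p q r s : int) :
  1 <= b -> 1 <= c -> 1 <= p -> 1 <= q -> 1 <= r -> 1 <= s ->
  q * r - p * s = 1 ->
  0 <= b * p * p + (d - a) * p * q - c * q * q ->
  b * r * r + (d - a) * r * s - c * s * s <= 0 -> False.
Proof.
move=> b1 c1 p1 q1 r1 s1 e hp hr.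
have rs : 0 <= (r * s) * (b * p * p + (d - a) * p * q - c * q * q).
  by apply: mulr_ge0 => //; nia.
have pq : (p * q) * (b * r * r + (d - a) * r * s - c * s * s) <= 0.
  by apply: mulr_ge0_le0 => //; nia.
have eq : (r * s) * (b * p * p + (d - a) * p * q - c * q * q) -
  (p * q) * (b * r * r + (d - a) * r * s - c * s * s) =
  - (b * p * r + c * q * s) * (q * r - p * s) by ring.
have h1 : 1 <= b * p * r by nia.
have h2 : 1 <= c * q * s by nia.
by move: eq; rewrite e; lia.
Qed.

(** If the second row of [Q] were negative, the off-diagonal entries of [X' = Q * X * Q^-1], being
    nonnegative, would give exactly the two sign hypotheses of [no_mixed_rows]. *)
Lemma conj_nonneg (X X' Q : 'M[int]_2) :
  nonneg_mx X' -> 1 <= X 0 1 -> 1 <= X 1 0 ->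
  \det Q = 1 -> X' * Q = Q * X ->
  1 <= Q 0 0 -> 1 <= Q 0 1 -> 0 < Q 1 0 * Q 1 1 -> nonneg_mx Q.
Proof.
move=> [_ nb nc _] xb xc detQ eXQ q1 q2 q34.
have [q3|q3] := leP 0 (Q 1 0); first by split; nia.
have q4 : Q 1 1 < 0 by nia.
have eX' : X' = Q * X * mx2 (Q 1 1) (- Q 0 1) (- Q 1 0) (Q 0 0).
  rewrite -eXQ -mulrA -[LHS]mulr1; congr (_ * _).
  by rewrite {1}[Q]mx2_eta mx2_mul mx2_1; move: detQ; rewrite mx2_det => detQ;
     congr mx2; lia.
exfalso; move: nb nc; rewrite eX' !mx2_mulE !mx2_ij => nb nc.
apply: (@no_mixed_rows (X 0 0) (X 0 1) (X 1 0) (X 1 1)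
  (Q 0 0) (Q 0 1) (- Q 1 0) (- Q 1 1)) => //; try lia.
- by move: detQ; rewrite mx2_det; lia.
Qed.

Lemma rot_of_word_conj s s' (P : 'M[int]_2) :
  2 < \tr (word_mx s) -> \det P = 1 ->
  psl_eq (word_mx s') (P * word_mx s * P^-1) -> exists k, s' = rot k s.
Proof.
move=> tr2 detP conj.
have uP := det1_unit detP.
(* The minus sign is excluded because word matrices have trace at least 2. *)
have eP : word_mx s' * P = P * word_mx s.
  case: conj => e; first by rewrite e mulrVK.
  have : \tr (word_mx s') = - \tr (word_mx s) by rewrite e raddfN /= tr_conj.
  by have := word_tr_ge2 s'; lia.
have s0 : (0 < size s)%N.
  by case: s tr2 {conj eP} => //; rewrite /word_mx big_nil mxtrace1.
have [xa xb xc xd] := word_pos tr2.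
(* This [n] makes [w] long enough for [row_same_sign] on both rows of [P]; the last factor
   [word_mx s], all of whose entries are positive, then makes every entry of [Q] nonzero. *)
pose n := (absz (P 0%R 0%R) + absz (P 0%R 1%R) +
           (absz (P 1%R 0%R) + absz (P 1%R 1%R)))%N.
pose w := flatten (nseq n s); pose Q : 'M[int]_2 := P * word_mx w * word_mx s.
have szw : (n <= size w)%N.
  by rewrite size_flatten /shape map_nseq sumn_nseq leq_pmull.
have eQ : word_mx s' * Q = Q * word_mx s.
  rewrite /Q word_mx_flatten -[P * _ * _]mulrA -exprSr exprS !mulrA eP.
  by rewrite -!mulrA -exprSr -exprS.
have detQ : \det Q = 1 by rewrite !det_mulr detP !det_word !mul1r.
have rowQ i : 0 < Q i 0 * Q i 1.
  have h : 0 <= (P * word_mx w) i 0 * (P * word_mx w) i 1.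
    apply: row_same_sign; apply: leq_trans szw; rewrite /n.
    by elim/ord2P: i; rewrite ?leq_addr ?leq_addl.
  have nz : (P * word_mx w) i 0 <> 0 \/ (P * word_mx w) i 1 <> 0.
    have : \det (P * word_mx w) = 1 by rewrite det_mulr detP det_word.
    rewrite mx2_det; move: (P * word_mx w) {h} => N detN.
    have [x0|] := eqVneq (N i 0) 0; last by left; apply/eqP.
    right=> y0; move: x0 y0 detN; elim/ord2P: i => -> ->; lia.
  rewrite /Q mx2_mulE [(_ * word_mx s) i 1]mx2_mulE.
  move: ((P * word_mx w) i 0) ((P * word_mx w) i 1) h nz => x y h nz.
  have [[x0 y0]|[x0 y0]] : (0 <= x /\ 0 <= y) \/ (x <= 0 /\ y <= 0) by nia.
    by apply: mulr_gt0; nia.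
  by rewrite nmulr_rgt0; nia.
move: (Q : 'M[int]_2) eQ detQ rowQ => {}Q eQ detQ rowQ.
have [s'p0 s'p1 s'p2 s'p3] := word_nonneg s'.
have nnX' : nonneg_mx (word_mx s') by split=> //; lia.
have [q eq] : exists q, word_mx s' * word_mx q = word_mx q * word_mx s.
  have q0 : 0 < Q 0 0 * Q 0 1 := rowQ 0; have q1 : 0 < Q 1 0 * Q 1 1 := rowQ 1.
  (* Both [Q] and [- Q] satisfy the conjugation equation; the one with positive first row is
     nonnegative. *)
  have [qpos|qneg] := leP 1 (Q 0 0).
    have q01 : 1 <= Q 0 1 by nia.
    have nnQ := conj_nonneg nnX' xb xc detQ eQ qpos q01 q1.
    by have [q qE] := word_mx_surj nnQ detQ; exists q; rewrite qE.
  have detQ' : \det (- Q) = 1 by rewrite mx2_det !mxE !mulrNN -mx2_det.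
  have nnQ : nonneg_mx (- Q).
    have h0 : 1 <= - Q 0 0.
      have : Q 0 0 != 0 by apply: contraTneq q0 => ->; rewrite mul0r.
      by lia.
    have h1 : 1 <= - Q 0 1 by nia.
    apply: (conj_nonneg nnX' xb xc detQ'); rewrite ?mxE ?mulrNN //.
    by rewrite mulrN eQ mulNr.
  have [q qE] := word_mx_surj nnQ detQ'; exists q.
  by rewrite qE mulrN eQ mulNr.
by apply: (@eq_cat_rot _ s s' q); apply: word_mx_inj; rewrite !word_mx_cat.
Qed.

(** * Conjugacy classes of words in the modular group *)

Lemma psl_eq_refl M : psl_eq M M. Proof. by left. Qed.

Lemma psl_eq_sym M N : psl_eq M N -> psl_eq N M.
Proof. by case=> ->; [left|right; rewrite opprK]. Qed.

Lemma psl_eq_trans M N K : psl_eq M N -> psl_eq N K -> psl_eq M K.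
Proof.
by case=> -> [] ->; [left|right|right|left; rewrite opprK].
Qed.

Lemma psl_eq_mul M N M' N' : psl_eq M M' -> psl_eq N N' ->
  psl_eq (M * N) (M' * N').
Proof.
by case=> -> [] ->; rewrite ?mulrN ?mulNr ?opprK; [left|right|right|left].
Qed.

Lemma psl_eq_tr M N : psl_eq M N -> `|\tr M| = `|\tr N|.
Proof. by case=> ->; rewrite ?raddfN ?normrN. Qed.

Lemma psl_class_tr M N : psl_class M N -> `|\tr M| = `|\tr N|.
Proof. by case=> P detP /psl_eq_tr ->; rewrite tr_conj. Qed.

Lemma psl_eq_class M N : psl_eq N M -> psl_class M N.
Proof. by move=> e; exists 1; rewrite ?det1 // invr1 mul1r mulr1. Qed.

Lemma psl_class_sym M N : psl_class M N -> psl_class N M.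
Proof.
case=> P detP e; exists P^-1; first exact: det1_inv.
have uP := det1_unit detP.
have {1}-> : M = P^-1 * (P * M * P^-1) * P^-1^-1.
  by rewrite invrK !mulrA mulVr // mul1r mulrVK.
by apply: psl_eq_mul (psl_eq_refl _); apply: psl_eq_mul (psl_eq_refl _) _;
   exact: psl_eq_sym.
Qed.

Lemma psl_class_trans M N K : psl_class M N -> psl_class N K -> psl_class M K.
Proof.
case=> P detP eP [Q detQ eQ]; exists (Q * P); first by rewrite det_mulr detP detQ.
have uP := det1_unit detP; have uQ := det1_unit detQ.
apply: psl_eq_trans eQ _; rewrite invrM //.
have -> : Q * P * M * (P^-1 * Q^-1) = Q * (P * M * P^-1) * Q^-1 by rewrite !mulrA.
by apply: psl_eq_mul (psl_eq_refl _); apply: psl_eq_mul (psl_eq_refl _) _.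
Qed.

Lemma psl_class_mulC M N : \det M = 1 -> psl_class (M * N) (N * M).
Proof.
move=> detM; exists M^-1; first exact: det1_inv.
by left; rewrite invrK mulrA mulVr ?det1_unit // mul1r.
Qed.

Lemma eq_psl_class M N : psl_class M = psl_class N <-> psl_class M N.
Proof.
split=> [->|h]; first exact/psl_eq_class/psl_eq_refl.
apply/seteqP; split=> K hK.
- exact: psl_class_trans (psl_class_sym h) hK.
- exact: psl_class_trans h hK.
Qed.

Definition sgn_of (b : bool) : int := if b then 1 else -1.

Definition genBs (b : bool) : 'M[int]_2 := genB ^ sgn_of b.

Lemma genB_V : genB^-1 = mx2 0 1 (-1) 1.
Proof.
have uB : genB \is a GRing.unit.
  by apply: det1_unit; rewrite mx2_det !mx2_ij.
by apply: (mulrI uB); rewrite mulrV // mx2_mul mx2_1.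
Qed.

Lemma genBsE b : genBs b = if b then genB else mx2 0 1 (-1) 1.
Proof. by case: b; rewrite /genBs /= ?expr1z // -genB_V. Qed.

Lemma genBs_sq b : psl_eq (genBs b * genBs b) (genBs (~~ b)).
Proof. by right; rewrite !genBsE; case: b; rewrite mx2_mul mx2_opp. Qed.

Lemma genBs_inv b : genBs b * genBs (~~ b) = 1.
Proof. by rewrite !genBsE mx2_1; case: b; rewrite mx2_mul. Qed.

Lemma det_genA : \det genA = 1. Proof. by rewrite mx2_det !mx2_ij. Qed.

Lemma genA_sq : genA * genA = - 1.
Proof. by rewrite mx2_mul mx2_1 mx2_opp. Qed.

Lemma det_genBs b : \det (genBs b) = 1.
Proof. by rewrite genBsE mx2_det; case: b; rewrite !mx2_ij. Qed.

Definition syllables (s : seq bool) : 'M[int]_2 :=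
  \prod_(b <- s) (genA * genBs b).

Lemma syllables_cons b s : syllables (b :: s) = genA * genBs b * syllables s.
Proof. exact: big_cons. Qed.

Lemma syllables_cat s s' : syllables (s ++ s') = syllables s * syllables s'.
Proof. exact: big_cat. Qed.

Lemma syllables_rcons s b : syllables (rcons s b) = syllables s * (genA * genBs b).
Proof. by rewrite -cats1 syllables_cat /syllables big_seq1. Qed.

Lemma det_syllables s : \det (syllables s) = 1.
Proof.
elim: s => [|b s ih]; first by rewrite /syllables big_nil det1.
by rewrite syllables_cons !det_mulr ih det_genA det_genBs.
Qed.

Definition reflection : 'M[int]_2 := mx2 1 0 0 (-1).

Lemma reflection_sq : reflection * reflection = 1.
Proof. by rewrite mx2_mul mx2_1. Qed.

Lemma reflection_mul M N :
  reflection * M * reflection * (reflection * N * reflection) =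
  reflection * (M * N) * reflection.
Proof.
by rewrite -!mulrA [reflection * (reflection * _)]mulrA reflection_sq mul1r.
Qed.

(* Conjugation by the reflection, of determinant -1, makes the syllables ab and
   ab^-1 nonnegative. *)
Lemma syllables_word s :
  psl_eq (syllables s) (reflection * word_mx s * reflection).
Proof.
elim: s => [|b s ih].
  by left; rewrite /syllables /word_mx !big_nil mulr1 reflection_sq.
have -> : reflection * word_mx (b :: s) * reflection =
  (reflection * letter_mx b * reflection) *
  (reflection * word_mx s * reflection).
  by rewrite word_mx_cons reflection_mul.
rewrite syllables_cons; apply: psl_eq_mul ih.
by rewrite genBsE; case: b; [right|left]; rewrite !mx2_mul ?mx2_opp.
Qed.

Lemma tr_reflection M : \tr (reflection * M * reflection) = \tr M.
Proof.
by rewrite -mulmxE mxtrace_mulC mulmxE mulrA reflection_sq mul1r.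
Qed.

Lemma tr_syllables s : `|\tr (syllables s)| = \tr (word_mx s).
Proof.
rewrite (psl_eq_tr (syllables_word s)) tr_reflection ger0_norm //.
by apply: le_trans (word_tr_ge2 s).
Qed.

Lemma psl_class_reflection M N : psl_class M N ->
  psl_class (reflection * M * reflection) (reflection * N * reflection).
Proof.
case=> P detP e; have uP := det1_unit detP.
have det' : \det (reflection * P * reflection) = 1.
  by rewrite !det_mulr detP mx2_det !mx2_ij.
exists (reflection * P * reflection) => //.
have -> : (reflection * P * reflection)^-1 = reflection * P^-1 * reflection.
  apply: (mulrI (det1_unit det')).
  by rewrite mulrV ?det1_unit // reflection_mul mulrV // mulr1 reflection_sq.
rewrite !reflection_mul; apply: psl_eq_mul (psl_eq_refl _).
exact: psl_eq_mul (psl_eq_refl _) e.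
Qed.

Lemma rot_of_syllables_conj s s' : 2 < \tr (word_mx s) ->
  psl_class (syllables s) (syllables s') -> exists k, s' = rot k s.
Proof.
have wE r : word_mx r = reflection * (reflection * word_mx r * reflection) * reflection.
  by rewrite -!mulrA reflection_sq mulr1 mulrA reflection_sq mul1r.
move=> tr2 h; have [P detP e] : psl_class (word_mx s) (word_mx s').
  rewrite (wE s) (wE s'); apply: psl_class_reflection.
  apply: psl_class_trans (psl_class_trans h _).
    exact/psl_eq_class/syllables_word.
  by apply: psl_class_sym; apply/psl_eq_class/syllables_word.
exact: rot_of_word_conj e.
Qed.

Lemma syllables_rot k s : psl_class (syllables s) (syllables (rot k s)).
Proof.
rewrite /rot syllables_cat -{1}[s](cat_take_drop k) syllables_cat.
exact/psl_class_mulC/det_syllables.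
Qed.

(* Normal form [b^i (ab^+-1) ... (ab^+-1) a^f] of a word of the free product. *)
Definition free_form (p : option bool) (s : seq bool) (f : bool) : 'M[int]_2 :=
  oapp genBs 1 p * syllables s * (if f then genA else 1).

Definition free_form_size (p : option bool) (s : seq bool) (f : bool) : nat :=
  isSome p + (size s).*2 + f.

(** A leading [b^+-1] is absorbed with [a] into a new syllable; otherwise [a] cancels the [a] in
    front, which uncovers a prefix [b^+-1]. *)
Lemma genA_free_form p s f : exists p' s' f',
  (free_form_size p' s' f' <= (free_form_size p s f).+1)%N /\
  psl_eq (genA * free_form p s f) (free_form p' s' f').
Proof.
rewrite /free_form /free_form_size; case: p => [b|] /=.
  exists None, (b :: s), f; split; first by rewrite /=; lia.
  by left; rewrite syllables_cons mul1r !mulrA.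
case: s => [|b s].
  exists None, [::], (~~ f); split; first by case: f.
  rewrite /syllables big_nil !mul1r; case: f => /=; last by rewrite mulr1; left.
  by right; rewrite genA_sq.
exists (Some b), s, f; split; first by rewrite /=; lia.
by right; rewrite syllables_cons mul1r !mulrA genA_sq !mulN1r !mulNr.
Qed.

Lemma genB_free_form b p s f : exists p' s' f',
  (free_form_size p' s' f' <= (free_form_size p s f).+1)%N /\
  psl_eq (genBs b * free_form p s f) (free_form p' s' f').
Proof.
rewrite /free_form /free_form_size; case: p => [c|] /=; last first.
  exists (Some b), s, f; split=> //=.
  by left; rewrite mul1r !mulrA.
have [->|neq] := eqVneq c b.
  exists (Some (~~ b)), s, f; split=> //=.
  rewrite !mulrA; apply: psl_eq_mul (psl_eq_refl _).
  by apply: psl_eq_mul (psl_eq_refl _); apply: genBs_sq.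
exists None, s, f; split; first by rewrite /=; lia.
have -> : c = ~~ b by case: (b) (c) neq => -[].
by left; rewrite !mulrA genBs_inv.
Qed.

Lemma word_free_form (w : seq 'M[int]_2) :
  {subset w <= [:: genA; genB; genB^-1]} -> exists p s f,
  (free_form_size p s f <= size w)%N /\
  psl_eq (\prod_(g <- w) g) (free_form p s f).
Proof.
elim: w => [|g w ih] sub.
  exists None, [::], false; split=> //.
  by left; rewrite /free_form /syllables !big_nil !mulr1.
have [ |p [s [f [le e]]]] := ih; first by move=> h hw; apply: sub; rewrite inE hw orbT.
have gA : g \in [:: genA; genB; genB^-1] by apply: sub; rewrite inE eqxx.
have [p' [s' [f' [le' e']]]] : exists p' s' f',
  (free_form_size p' s' f' <= (free_form_size p s f).+1)%N /\
  psl_eq (g * free_form p s f) (free_form p' s' f').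
  move: gA; rewrite !inE => /or3P[] /eqP ->.
  - exact: genA_free_form.
  - by have := genB_free_form true p s f; rewrite genBsE.
  - by have := genB_free_form false p s f; rewrite genBsE -genB_V.
exists p', s', f'; split; first exact: leq_trans le' _.
rewrite big_cons; apply: psl_eq_trans e'.
exact: psl_eq_mul (psl_eq_refl _) e.
Qed.

(** Cyclic reduction: the first factor is moved to the end, or the last to the front, and each
    cancellation removes a syllable. The trace hypothesis excludes ending at [a] or [b^+-1]. *)
Lemma free_form_conj p s f : 2 < `|\tr (free_form p s f)| ->
  exists2 s', psl_class (free_form p s f) (syllables s') &
    ((size s').*2 <= free_form_size p s f)%N.
Proof.
have [n] := ubnP (size s); elim: n => // n ih in p s f *; move=> szs.
(* Induction step: [N * M] is conjugate to [M * N], so it suffices that it has fewer syllables and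
   is no longer. *)
have red M N p' s' f' : \det M = 1 -> free_form p s f = M * N ->
    psl_eq (N * M) (free_form p' s' f') -> (size s' < size s)%N ->
    (free_form_size p' s' f' <= free_form_size p s f)%N ->
    2 < `|\tr (free_form p s f)| ->
    exists2 s', psl_class (free_form p s f) (syllables s') &
      ((size s').*2 <= free_form_size p s f)%N.
  move=> detM eMN e lt le tr2.
  have cl : psl_class (free_form p s f) (free_form p' s' f').
    rewrite eMN; apply: psl_class_trans (psl_class_mulC _ detM) _.
    exact/psl_eq_class/psl_eq_sym.
  have [| |r hr ler] := ih p' s' f'.
  - exact: leq_trans lt szs.
  - by rewrite -(psl_class_tr cl).
  exists r; first exact: psl_class_trans cl hr.
  exact: leq_trans ler le.
case: p f red => [b|] [] red.
- move=> _; exists (b :: s); last by rewrite /free_form_size /=; lia.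
  apply: psl_class_trans (psl_class_sym (psl_class_mulC _ det_genA)) _.
  by apply: psl_eq_class; left; rewrite syllables_cons !mulrA.
(* The prefix [b^i] meets the final [b^j]: equal exponents merge into [b^-i], opposite ones cancel
   and leave a trailing [a]. *)
- case/lastP: s szs red => [|s c] szs red.
    rewrite /free_form /syllables big_nil !mulr1 /= genBsE mx2_tr.
    by case: b {red}; rewrite !mx2_ij.
  have [ecb|neq] := eqVneq c b.
    move=> _; exists (rcons s (~~ b)); last first.
      by rewrite /free_form_size !size_rcons; lia.
    rewrite /free_form mulr1 /=.
    apply: psl_class_trans (psl_class_mulC _ (det_genBs b)) _.
    apply/psl_eq_class; rewrite ecb !syllables_rcons -!mulrA.
    do 2!apply: psl_eq_mul (psl_eq_refl _) _.
    exact/psl_eq_sym/genBs_sq.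
  apply: (red (genBs b) (syllables (rcons s c)) None s true).
  - exact: det_genBs.
  - by rewrite /free_form mulr1.
  - left; rewrite syllables_rcons /free_form mul1r -!mulrA.
    have -> : b = ~~ c by case: (b) (c) neq => -[].
    by rewrite genBs_inv mulr1.
  - by rewrite size_rcons.
  - by rewrite /free_form_size size_rcons /=; lia.
(* The trailing [a], moved to the front, cancels the [a] of the first syllable. *)
- case: s szs red => [|b s] szs red.
    by rewrite /free_form /syllables big_nil !mul1r /= mx2_tr !mx2_ij.
  apply: (red (syllables (b :: s)) genA (Some b) s false).
  - exact: det_syllables.
  - by rewrite /free_form mul1r.
  - right; rewrite syllables_cons /free_form mulr1 !mulrA genA_sq.
    by rewrite !mulN1r !mulNr.
  - by [].
  - by rewrite /free_form_size /=; lia.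
- move=> _; exists s; last by rewrite /free_form_size /=; lia.
  by apply: psl_eq_class; left; rewrite /free_form mul1r mulr1.
Qed.

(** Normalizing and cyclically reducing [w] never lengthens it, and the result is a rotation of [s],
    hence of the same size. *)
Lemma syllables_word_size s (w : seq 'M[int]_2) : 2 < \tr (word_mx s) ->
  {subset w <= [:: genA; genB; genB^-1]} ->
  psl_class (syllables s) (\prod_(g <- w) g) -> ((size s).*2 <= size w)%N.
Proof.
move=> tr2 sub cl; have [p [s1 [f [le e]]]] := word_free_form sub.
have cl1 : psl_class (syllables s) (free_form p s1 f).
  by apply: psl_class_trans cl _; exact/psl_eq_class/psl_eq_sym.
have [|s2 cl2 le2] := @free_form_conj p s1 f.
  by rewrite -(psl_class_tr cl1) tr_syllables.
have [k ek] := rot_of_syllables_conj tr2 (psl_class_trans cl1 cl2).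
by rewrite -(size_rot k s) -ek; exact: leq_trans le2 le.
Qed.

Lemma syllables_letters s : exists w : seq 'M[int]_2,
  [/\ {subset w <= [:: genA; genB; genB^-1]},
      syllables s = \prod_(g <- w) g & size w = (size s).*2].
Proof.
elim: s => [|b s [w [sub e sz]]].
  by exists [::]; split=> //; rewrite /syllables !big_nil.
exists [:: genA, genBs b & w]; split; last by rewrite /= sz.
- move=> g; rewrite !inE => /or3P[/eqP ->|/eqP ->|/sub]; last by rewrite !inE.
    by rewrite eqxx.
  by rewrite genBsE; case: b; rewrite -?genB_V eqxx ?orbT.
- by rewrite syllables_cons !big_cons e mulrA.
Qed.

Lemma class_length_syllables s : 2 < \tr (word_mx s) ->
  class_length (psl_class (syllables s)) (size s).*2.
Proof.
move=> tr2; have [w [sub e sz]] := syllables_letters s; split; last first.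
  move=> m [M clM [[w' [sub' e' <-]] _]].
  apply: syllables_word_size sub' _ => //.
  by apply: psl_class_trans clM _; exact/psl_eq_class/psl_eq_sym.
exists (syllables s); first exact/psl_eq_class/psl_eq_refl.
split; first by exists w; rewrite e; split=> //; left.
move=> m [w' [sub' e' <-]]; apply: syllables_word_size sub' _ => //.
exact/psl_eq_class/psl_eq_sym.
Qed.

Lemma class_length_uniq gamma m n :
  class_length gamma m -> class_length gamma n -> m = n.
Proof.
by move=> [hm minm] [hn minn]; apply/eqP; rewrite eqn_leq minm ?minn.
Qed.

(** * Axes through the fixed point i of [genA] *)

Lemma genA_order_two : order_two genA.
Proof.
split; last by right; rewrite genA_sq.
by rewrite /psl_eq mx2_1 mx2_opp => -[] /mx2_inj[].
Qed.

Lemma genA_fixes_i (R : realType) : moebius_fixes genA (Complex 0 1 : complex R).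
Proof.
rewrite /moebius_fixes !mx2_ij mul0r add0r mulr1z mul1r addr0.
have nz : Complex 0 1 != 0 :> complex R by rewrite eq_complex /= oner_eq0 andbF.
split=> //; apply: (mulIf nz); rewrite mulfVK //.
by apply/eqP; rewrite eq_complex /=; apply/andP; split; apply/eqP; ring.
Qed.

(** The number [x] is a root of the fixed-point equation [b x^2 + (d - a) x - b = 0], whose
    discriminant is [(a + d)^2 - 4] because the determinant is 1. *)
Lemma symmetric_fixes (F : realFieldType) (a b d r : F) :
  b != 0 -> b * b = a * d - 1 -> r ^+ 2 = (a + d) ^+ 2 - 4 ->
  let x := (a - d + r) / 2 / b in
  b * x + d != 0 /\ (a * x + b) / (b * x + d) = x.
Proof.
move=> b0 bb rr x; have bx : b * x = (a - d + r) / 2 by rewrite mulrC divfK.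
have den : b * x + d != 0.
  rewrite bx; apply/eqP => z; have er : r = - (a + d) by lra.
  by move: rr; rewrite er sqrrN => ?; lra.
split=> //; apply: (mulIf den); rewrite divfK //; apply: (mulfI b0).
have -> : b * (a * x + b) = a * (b * x) + b * b by ring.
have -> : b * (x * (b * x + d)) = (b * x) * (b * x + d) by ring.
by rewrite bx bb; lra.
Qed.

(* A symmetric matrix is reversed by a: its axis is stable under z -> -1/z,
   hence passes through i. *)
Lemma axis_symmetric (R : realType) (M : 'M[int]_2) :
  \det M = 1 -> hyperbolic M -> M 0 1 = M 1 0 ->
  axis M (Complex 0 1 : complex R).
Proof.
rewrite /hyperbolic mx2_det mx2_tr => detM tr2 sym.
have nz : M 1 0 != 0.
  apply/eqP => z; move: detM tr2; rewrite sym z mul0r subr0.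
  move: (M 0 0) (M 1 1) => x y xy1.
  have [x1|x0] := leP 1 x.
    have y1 : 1 <= y by nia.
    have : 0 <= (x - 1) * (y - 1) by rewrite mulr_ge0 //; lia.
    by lia.
  have nx0 : x != 0 by apply: contra_eq_neq xy1 => ->; rewrite mul0r.
  have x1 : x <= - 1 by lia.
  have y1 : y <= - 1 by nia.
  have : 0 <= (x + 1) * (y + 1) by rewrite mulr_le0 //; lia.
  by lia.
pose a : R := (M 0 0)%:~R; pose b : R := (M 1 0)%:~R; pose d : R := (M 1 1)%:~R.
have b0 : b != 0 by rewrite intr_eq0.
have e1 : b * b = a * d - 1.
  rewrite -[X in _ - X](mulr1z 1) -detM sym rmorphB /= !rmorphM /=.
  by rewrite opprB addrC subrK.
have tr : 4 < (a + d) ^+ 2.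
  have h : 4 < (M 0 0 + M 1 1) ^+ 2 by nia.
  by move: h; rewrite -(ltr_int R) rmorphXn /= intrD.
pose D := (a + d) ^+ 2 - 4; pose q := Num.sqrt D.
have qq : q ^+ 2 = D by rewrite sqr_sqrtr // subr_ge0 ltW.
have q0 : 0 < q by rewrite sqrtr_gt0 subr_gt0.
have fix1 r : r ^+ 2 = D -> moebius_fixes M ((a - d + r) / 2 / b).
  by move=> rr; rewrite /moebius_fixes sym; apply: symmetric_fixes.
exists ((a - d + q) / 2 / b), ((a - d + - q) / 2 / b); split.
- rewrite -subr_eq0.
  have -> : (a - d + q) / 2 / b - (a - d + - q) / 2 / b = q / b by field.
  by rewrite mulf_neq0 ?invr_eq0 // gt_eqF.
- exact: fix1.
- by apply: fix1; rewrite sqrrN.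
- split=> /=; first exact: ltr01.
  (* Multiplied by [b * b], the equation of the circle at i becomes
     [(a - d)^2 / 4 + b^2 = q^2 / 4]. *)
  apply: (mulfI (mulf_neq0 b0 b0)).
  have -> : b * b * (((a - d + q) / 2 / b - (a - d + - q) / 2 / b) / 2) ^+ 2 =
    q ^+ 2 / 4 by field.
  have -> : b * b * ((0 - ((a - d + q) / 2 / b + (a - d + - q) / 2 / b) / 2) ^+ 2
    + 1 ^+ 2) = (a - d) ^+ 2 / 4 + b * b by field.
  by rewrite qq e1 /D; field.
Qed.

(** * Antipalindromes and runs *)

(** The involution whose fixed words are the antipalindromes; on word matrices it is
    transposition. *)
Definition skew_rev (s : seq bool) : seq bool := rev (map negb s).

Lemma skew_revK : involutive skew_rev.
Proof.
move=> s; rewrite /skew_rev map_rev revK -map_comp map_id_in // => b _ /=.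
by rewrite negbK.
Qed.

Lemma size_skew_rev s : size (skew_rev s) = size s.
Proof. by rewrite /skew_rev size_rev size_map. Qed.

(** Dihedral relation: [skew_rev] conjugates a rotation into its inverse. *)
Lemma rot1_skew_rev s : rot 1 (skew_rev (rot 1 s)) = skew_rev s.
Proof. by rewrite /skew_rev map_rot rev_rot rotrK. Qed.

Lemma last_skew_rev x s : skew_rev (x :: s) = x :: s -> last x s = ~~ x.
Proof.
move=> e; have := congr1 (last x) e.
by rewrite /skew_rev map_cons rev_cons last_rcons /= => <-.
Qed.

Definition antipal (w : seq bool) : seq bool := w ++ skew_rev w.

Lemma skew_rev_antipal w : skew_rev (antipal w) = antipal w.
Proof.
rewrite {1}/antipal /skew_rev map_cat rev_cat -/(skew_rev w).
by rewrite -/(skew_rev (skew_rev w)) skew_revK.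
Qed.

Lemma size_antipal w : size (antipal w) = (size w).*2.
Proof. by rewrite size_cat size_skew_rev addnn. Qed.

Lemma antipal_inj : injective antipal.
Proof.
move=> w w' e; have := congr1 size e; rewrite !size_antipal => /double_inj sz.
by move/eqP: e; rewrite /antipal eqseq_cat // => /andP[/eqP].
Qed.

Lemma antipal_take t s : size s = t.*2 -> skew_rev s = s -> antipal (take t s) = s.
Proof.
move=> sz e; rewrite -[RHS](cat_take_drop t) /antipal; congr cat.
by rewrite -[in RHS]e /skew_rev drop_rev size_map sz -addnn addnK map_take.
Qed.

Lemma iter_rot1 (s : seq bool) k : (k <= size s)%N -> iter k (rot 1) s = rot k s.
Proof.
elim: k => [|k ih] lt; first by rewrite rot0.
by rewrite iterS ih 1?ltnW // (rotS lt).
Qed.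

Lemma iter_rot_skew_rev s k :
  iter k (rot 1) (skew_rev (iter k (rot 1) s)) = skew_rev s.
Proof.
by elim: k => // k ih; rewrite iterSr iterS rot1_skew_rev ih.
Qed.

(* The rotations of an antipalindrome s that are antipalindromes are those by k
   such that the least period p of s divides 2k; as p is even they are the two
   rotations by 0 and p / 2. *)
Lemma antipal_rotations (w : seq bool) : w <> [::] ->
  exists2 w2, w2 <> w &
    forall w', (exists k, antipal w' = rot k (antipal w)) <-> w' = w \/ w' = w2.
Proof.
move=> w0; set s := antipal w; pose r := @rot bool 1.
have sS : skew_rev s = s := skew_rev_antipal w.
have szs : (0 < size s)%N by rewrite size_antipal double_gt0; case: (w) w0.
have iinj k : injective (iter k r) by elim: k => // k ih x y /rot_inj/ih.
have exp : exists p, (0 < p)%N && (iter p r s == s).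
  by exists (size s); rewrite szs iter_rot1 // rot_size /=.
case: (ex_minnP exp) => p /andP[p0 /eqP ps] pmin.
have perM j : iter (j * p) r s = s by elim: j => // j ih; rewrite mulSn iterD ih.
have perP j : iter j r s = s -> (p %| j)%N.
  move=> js; rewrite /dvdn; apply: contraT; rewrite -lt0n => m0.
  have : (p <= j %% p)%N.
    apply: pmin; rewrite m0 /=; apply/eqP; rewrite -[RHS]js {2}(divn_eq j p).
    by rewrite addnC iterD perM.
  by rewrite leqNgt ltn_mod p0.
have symP k : skew_rev (iter k r s) = iter k r s -> (p %| k + k)%N.
  by move=> e; apply: perP; rewrite iterD -{1}e iter_rot_skew_rev.
have symI i j : (i + j = p)%N -> skew_rev (iter i r s) = iter j r s.
  move=> ij; apply: (iinj i); rewrite iter_rot_skew_rev -iterD ij ps.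
  exact: sS.
have [m em] : exists m, p = (m + m)%N.
  have [podd|peven] := boolP (odd p); last first.
    by exists p./2; rewrite addnn even_halfK.
  (* For odd [p], [symI] splits [p] into two consecutive integers; the first letter of this rotation
     would then equal its own negation. *)
  have : skew_rev (rot 1 (iter p./2 r s)) = iter p./2 r s.
    by apply: (symI p./2.+1 p./2); rewrite addSn addnn -[RHS]odd_double_half podd.
  have : size (iter p./2 r s) = size s by elim: (p./2) => //= k; rewrite size_rot.
  case: (iter _ _ _) => [|x z]; first by move=> s0; rewrite -s0 in szs.
  by move=> _; rewrite rot1_cons /skew_rev map_rcons rev_rcons => -[]; case: (x).
have m0 : (0 < m)%N by lia.
have [mlt ple] : (m < p)%N /\ (p <= size s)%N.
  split; first by lia.
  by apply: pmin; rewrite szs iter_rot1 // rot_size /=.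
pose s2 := iter m r s.
have s2S : skew_rev s2 = s2 by apply: symI.
have szs2 : size s2 = (size w).*2.
  rewrite /s2 iter_rot1 ?size_rot ?size_antipal // -?size_antipal.
  by apply: leq_trans ple; lia.
have s2w := antipal_take szs2 s2S.
have s2E : s2 = rot m s by rewrite /s2 iter_rot1 //; lia.
exists (take (size w) s2).
  move=> e; have : iter m r s = s by rewrite -/s2 -s2w e.
  by move/perP => /dvdn_leq; lia.
move=> w'; split; last first.
  case=> ->; first by exists 0; rewrite rot0.
  by exists m; rewrite s2w.
move=> [k0 e0]; have [k e] : exists k, antipal w' = iter k r s.
  have [le|lt] := leqP k0 (size s); first by exists k0; rewrite iter_rot1.
  by exists 0; rewrite e0 rot_oversize // ltnW.
have : (p %| k + k)%N by apply: symP; rewrite -e skew_rev_antipal.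
rewrite em !addnn -!mul2n dvdn_pmul2l // => /dvdnP[j ej].
(* Here [k = j * m] with [p = m + m], so only the parity of [j] matters. *)
have [od|ev] := boolP (odd j); [right|left]; apply: antipal_inj; rewrite e.
- rewrite s2w ej -[j]odd_double_half od mulnDl mul1n iterD.
  by rewrite -muln2 -mulnA mul2n -addnn -em perM.
- by rewrite ej -[j]odd_double_half (negbTE ev) -muln2 -mulnA mul2n -addnn -em perM.
Qed.

Lemma sgn_of_negb b : sgn_of (~~ b) = - sgn_of b. Proof. by case: b. Qed.

Lemma sgn_of_inj : injective sgn_of. Proof. by case=> -[]. Qed.

Lemma antipalindrome_sgn w : antipalindrome (map sgn_of w) = map sgn_of (antipal w).
Proof.
rewrite /antipalindrome /antipal /skew_rev map_cat map_rev -!map_comp.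
by congr (_ ++ rev _); apply: eq_map => b /=; rewrite sgn_of_negb.
Qed.

Lemma normal_form_sgn w : normal_form (map sgn_of w) = syllables (antipal w).
Proof. by rewrite /normal_form antipalindrome_sgn big_map. Qed.

Lemma sign_seqP e : is_sign_seq e <-> exists2 w, w <> [::] & e = map sgn_of w.
Proof.
split=> [[e0 sub]|[w w0 ->]].
  exists (map (fun x => x == 1) e); first by case: (e) e0.
  rewrite -map_comp map_id_in // => x /sub /=.
  by rewrite !inE => /orP[] /eqP ->.
split; first by case: (w) w0.
by move=> x /mapP[[] _ ->]; rewrite !inE.
Qed.

Lemma mem_antipal b w : w <> [::] -> b \in antipal w.
Proof.
case: w => // x w _; rewrite mem_cat /skew_rev mem_rev map_cons !inE.
by case: b x => -[]; rewrite ?orbT.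
Qed.

Lemma antipal_tr_gt2 w : w <> [::] -> 2 < \tr (word_mx (antipal w)).
Proof. by move=> w0; apply: word_tr_gt2; exact: mem_antipal. Qed.

(** The matrices [L] and [U] are transposes of each other. *)
Lemma word_mx_skew_rev s : word_mx (skew_rev s) = (word_mx s)^T.
Proof.
elim: s => [|b s ih]; first by rewrite /word_mx big_nil trmx1.
rewrite word_mx_cons -mulmxE trmx_mul mulmxE -ih /skew_rev map_cons rev_cons.
rewrite -cats1 word_mx_cat; congr (_ * _); rewrite /word_mx big_seq1.
by case: b; rewrite [RHS]mx2_eta ![_^T _ _]mxE !mx2_ij.
Qed.

Lemma syllables_antipal_sym w :
  syllables (antipal w) 0 1 = syllables (antipal w) 1 0.
Proof.
have sym : word_mx (antipal w) 0 1 = word_mx (antipal w) 1 0.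
  by rewrite -{1}(skew_rev_antipal w) word_mx_skew_rev mxE.
move: (syllables_word (antipal w)); rewrite [word_mx _]mx2_eta sym !mx2_mul.
by case=> ->; rewrite ?mx2_opp !mx2_ij; ring.
Qed.

(** * Geodesics from half words *)

Definition geodesic (w : seq bool) : set 'M[int]_2 := psl_class (syllables (antipal w)).

Lemma geodesic_reciprocal (R : realType) w : w <> [::] ->
  reciprocal_geodesic R (geodesic w).
Proof.
move=> w0; have hyp : hyperbolic (syllables (antipal w)).
  by rewrite /hyperbolic tr_syllables; exact: antipal_tr_gt2.
exists (syllables (antipal w)); split=> //; first exact: det_syllables.
exists genA, (Complex 0 1); split.
- exact: det_genA.
- exact: genA_order_two.
- exact: ltr01.
- exact: genA_fixes_i.
- apply: axis_symmetric hyp _; first exact: det_syllables.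
  exact: syllables_antipal_sym.
Qed.

Lemma geodesic_length w : w <> [::] -> class_length (geodesic w) (4 * size w)%N.
Proof.
move=> w0; have -> : (4 * size w = (size (antipal w)).*2)%N.
  by rewrite size_antipal; lia.
exact/class_length_syllables/antipal_tr_gt2.
Qed.

Lemma eq_geodesic w w' : w <> [::] ->
  geodesic w = geodesic w' <-> exists k, antipal w' = rot k (antipal w).
Proof.
move=> w0; rewrite eq_psl_class; split=> [|[k ->]].
  by apply: rot_of_syllables_conj; exact: antipal_tr_gt2.
exact: syllables_rot.
Qed.

(** * Runs of sign sequences *)

Lemma run_seq_map (T T' : eqType) (f : T -> T') s : injective f ->
  run_seq (map f s) = run_seq s.
Proof.
move=> finj; elim: s => //= x s ->; case: s => //= y s.
by rewrite /eq_op /= -!/(eq_op _ _) (inj_eq finj).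
Qed.

Lemma run_seq_eq0 (T : eqType) (s : seq T) : (run_seq s == [::]) = (s == [::]).
Proof. by case: s => //= x s; case: ifP => // _; case: (run_seq s). Qed.

Lemma run_seq_cons (T : eqType) (x : T) s : run_seq (x :: s) =
  if ohead s == Some x then incr_nth (run_seq s) 0 else 1%N :: run_seq s.
Proof. by []. Qed.

Lemma run_seq_cat (T : eqType) (x : T) u v :
  ohead v != Some (last x u) ->
  run_seq (x :: u ++ v) = run_seq (x :: u) ++ run_seq v.
Proof.
elim: u x => [|y u ih] x h; first by rewrite /= (negbTE h).
rewrite cat_cons run_seq_cons ih // [run_seq (x :: y :: u)]run_seq_cons /=.
case: ifP => // _; have := run_seq_eq0 (y :: u).
by rewrite -/(run_seq (y :: u)); case: (run_seq (y :: u)).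
Qed.

Lemma run_seq_nseq (T : eqType) (x : T) k : run_seq (nseq k.+1 x) = [:: k.+1].
Proof. by elim: k => // k ih; rewrite [nseq _ _]/= run_seq_cons ih /= eqxx. Qed.

Lemma first_runP (T : eqType) (x : T) s : exists k s',
  x :: s = nseq k.+1 x ++ s' /\ ohead s' != Some x.
Proof.
elim: s x => [|y s ih] x; first by exists 0%N, [::].
have [eyx|neq] := eqVneq y x; last first.
  by exists 0%N, (y :: s); split=> //; apply: contra_neq neq => -[].
have [k [s' [e h]]] := ih x; by exists k.+1, s'; rewrite eyx e.
Qed.

Lemma ohead_rev (T : eqType) (x : T) s : ohead (rev (x :: s)) = Some (last x s).
Proof. by rewrite lastI rev_rcons. Qed.

(** The first maximal run is split off; it becomes the last run of the reversed word. *)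
Lemma run_seq_rev (T : eqType) (s : seq T) : run_seq (rev s) = rev (run_seq s).
Proof.
have [n] := ubnP (size s); elim: n => // n ih in s *; case: s => // x s szs.
have [k [s' [e h]]] := first_runP x s.
have lt : (size s' < n)%N.
  by have := congr1 size e; move: szs; rewrite size_cat size_nseq /=; lia.
have lastn : last x (nseq k x) = x by elim: (k).
have revn : rev (nseq k.+1 x) = nseq k.+1 x.
  by apply: (@eq_from_nth _ x); rewrite size_rev // => i; rewrite size_nseq => lti;
     rewrite nth_rev ?size_nseq // !nth_nseq !if_same.
have -> : run_seq (x :: s) = k.+1 :: run_seq s'.
  by rewrite e [nseq k.+1 x ++ s']cat_cons run_seq_cat ?lastn // run_seq_nseq.
rewrite e rev_cat revn rev_cons -ih // -cats1 -(run_seq_nseq x).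
case: s' {e lt} h => [|y s'] h; first by [].
case er : (rev (y :: s')) => [|z r]; first by move/(congr1 size): er; rewrite size_rev.
rewrite cat_cons run_seq_cat //; have : last x (rev (y :: s')) = y.
  by rewrite rev_cons last_rcons.
by rewrite er /= => ->; rewrite eq_sym.
Qed.

Definition long_runs (D : nat) (w : seq bool) : nat :=
  count (fun r => D < r)%N (run_seq w).

Lemma long_runs_cat D x u v : ohead v != Some (last x u) ->
  long_runs D (x :: u ++ v) = (long_runs D (x :: u) + long_runs D v)%N.
Proof. by move=> h; rewrite /long_runs run_seq_cat // count_cat. Qed.

Lemma long_runs_skew_rev D w : long_runs D (skew_rev w) = long_runs D w.
Proof.
rewrite /long_runs /skew_rev run_seq_rev count_rev run_seq_map //.
exact: can_inj negbK.
Qed.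

(** No run crosses the centre: the second half starts with the negation of the last letter of the
    first half. *)
Lemma long_runs_antipal D w : long_runs D (antipal w) = (long_runs D w).*2.
Proof.
case: w => // x w; rewrite /antipal cat_cons long_runs_cat.
  by rewrite long_runs_skew_rev addnn.
rewrite /skew_rev ohead_rev; apply/eqP => -[].
by rewrite -/(map negb (x :: w)) last_map; case: last.
Qed.

(** A word fixed by [skew_rev] ends with the negation of its first letter. Applied to both words,
    this shows that no run crosses either junction of [u] and [v]. *)
Lemma long_runs_catC D u v : skew_rev (u ++ v) = u ++ v ->
  skew_rev (v ++ u) = v ++ u -> long_runs D (v ++ u) = long_runs D (u ++ v).
Proof.
case: u v => [|x u] [|y v]; rewrite ?cats0 // => e1 e2.
have /= := last_skew_rev e1; have /= := last_skew_rev e2.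
rewrite !last_cat /= => lu lv.
rewrite !long_runs_cat 1?addnC //=.
- by rewrite lu; case: (y).
- by rewrite lv; case: (x).
Qed.

Lemma excursions_sgn D w : excursions D (map sgn_of w) = (long_runs D w).*2.
Proof.
rewrite /excursions antipalindrome_sgn run_seq_map; last exact: sgn_of_inj.
exact: long_runs_antipal.
Qed.

Lemma long_runs_geodesic D w w' : w <> [::] -> geodesic w = geodesic w' ->
  long_runs D w = long_runs D w'.
Proof.
move=> w0 /(eq_geodesic _ w0) [k e]; apply: double_inj.
rewrite -!long_runs_antipal e -{1}(cat_take_drop k (antipal w)).
by rewrite -long_runs_catC // ?cat_take_drop -?/(rot k _) -?e skew_rev_antipal.
Qed.

Lemma excursion_setE (R : realType) D n t : (0 < t)%N ->
  [set gamma | excursion_set R D (2 * n) gamma /\ class_length gamma (4 * t)%N] =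
  geodesic @` [set w | size w = t /\ long_runs D w = n].
Proof.
move=> t0; apply/seteqP; split=> gamma /=.
  move=> [[[M [_ _ eg _]] [e [/sign_seqP [w w0 ->] gw exc]]] len].
  have eg' : gamma = geodesic w.
    by rewrite eg in gw *; apply/eq_psl_class; rewrite -normal_form_sgn.
  exists w; last by [].
  split; last by move: exc; rewrite excursions_sgn; lia.
  have := class_length_uniq len; rewrite eg' => /(_ _ (geodesic_length w0)).
  by lia.
move=> [w [sz lr] <-]; have w0 : w <> [::] by move=> e; rewrite -sz e in t0.
split; last by rewrite -sz; exact: geodesic_length.
split; first exact: geodesic_reciprocal.
exists (map sgn_of w); split.
- by apply/sign_seqP; exists w.
- by rewrite normal_form_sgn; exact/psl_eq_class/psl_eq_refl.
- by rewrite excursions_sgn lr; lia.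
Qed.

(** * Counting sign sequences *)

Fixpoint words (t : nat) : seq (seq bool) :=
  if t is t'.+1 then
    [seq true :: w | w <- words t'] ++ [seq false :: w | w <- words t']
  else [:: [::]].

Lemma mem_map_cons (T : eqType) (b c : T) w s :
  (b :: w \in [seq c :: u | u <- s]) = (b == c) && (w \in s).
Proof.
apply/mapP/andP => [[u us [-> ->]]|[/eqP -> ws]]; first by rewrite eqxx.
by exists w.
Qed.

Lemma mem_words w t : (w \in words t) = (size w == t).
Proof.
elim: t w => [|t ih] w; first by rewrite inE size_eq0.
rewrite /= mem_cat; case: w => [|b w]; first by apply/negP => /orP[] /mapP[].
by rewrite !mem_map_cons !ih eqSS; case: b; rewrite ?orbF.
Qed.

Lemma uniq_words t : uniq (words t).
Proof.
have inj b : injective (fun w : seq bool => b :: w) by move=> ? ? [].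
elim: t => //= t ih; rewrite cat_uniq !(map_inj_uniq (inj _)) ih /= andbT.
by apply/hasPn => _ /mapP[w _ ->]; rewrite /= mem_map_cons.
Qed.

Lemma count_wordsS P t : count P (words t.+1) =
  (count (fun w => P (true :: w)) (words t) +
   count (fun w => P (false :: w)) (words t))%N.
Proof. by rewrite count_cat !count_map. Qed.

Lemma size_undup_double (T : eqType) (s : seq T) :
  {in s, forall y, count_mem y s = 2} -> (size (undup s)).*2 = size s.
Proof.
move=> h; have := big_undup_iterop_count addn s xpredT (fun=> 1%N).
rewrite sum1_size => <-; rewrite (eq_big_seq (fun=> 2)) => [|y].
  by rewrite big_const_seq count_predT iter_addn_0 mul2n.
by rewrite mem_undup => /h ->.
Qed.

(** The map [geodesic] is two-to-one: the fibre of a class consists of [w] and the second word given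
    by [antipal_rotations], which agree in length and in number of long runs. *)
Lemma excursion_count_double (R : realType) D n t : (0 < t)%N ->
  (excursion_count R D (2 * n) t).*2 =
  count (fun w => long_runs D w == n) (words t).
Proof.
move=> t0; rewrite /excursion_count excursion_setE //.
set P := fun w => long_runs D w == n.
pose s := [seq geodesic w | w <- words t & P w].
have -> : geodesic @` [set w | size w = t /\ long_runs D w = n] =
          [set` [fset x in s]%fset].
  apply/seteqP; split=> y /=.
    move=> [w [sz lr] <-]; rewrite inE; apply/mapP; exists w => //.
    by rewrite mem_filter mem_words /P lr sz !eqxx.
  rewrite inE => /mapP[w]; rewrite mem_filter mem_words => /andP[/eqP lr /eqP sz] ->.
  by exists w.
rewrite set_fsetK card_fseq -size_filter -(size_map geodesic) -/s.
apply: size_undup_double => y /mapP[w]; rewrite mem_filter mem_words.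
move=> /andP[/eqP lr /eqP sz] ->.
have w0 : w <> [::] by move=> e; rewrite -sz e in t0.
have [w2 neq w2P] := antipal_rotations w0.
rewrite count_map -size_filter.
have -> : 2 = size [:: w; w2] by [].
apply/perm_size/uniq_perm; first by rewrite !filter_uniq // uniq_words.
  by rewrite /= inE andbT; apply/eqP => e; apply: neq.
move=> w'; rewrite !mem_filter mem_words !inE /=; apply/andP/orP.
  move=> [/eqP e _]; have /w2P : exists k, antipal w' = rot k (antipal w).
    exact/eq_geodesic.
  by case=> ->; rewrite eqxx; [left|right].
move=> ww; have e : geodesic w = geodesic w'.
  by apply/eq_geodesic => //; apply/w2P; case: ww => /eqP; [left|right].
rewrite /P -(long_runs_geodesic D w0 e) lr e !eqxx; split=> //=.
have [k] := (eq_geodesic w' w0).1 e.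
by move/(congr1 size); rewrite size_rot !size_antipal sz => /double_inj ->.
Qed.

Definition first_run (w : seq bool) : nat := head 0%N (run_seq w).

Lemma long_runs_cons_neq D b w : (0 < D)%N -> ohead w != Some b ->
  long_runs D (b :: w) = long_runs D w /\ first_run (b :: w) = 1%N.
Proof.
move=> D0 h; rewrite /long_runs /first_run run_seq_cons (negbTE h) /=.
by rewrite ltnNge D0.
Qed.

Lemma long_runs_cons_eq D b w : ohead w = Some b ->
  long_runs D (b :: w) = ((first_run w == D) + long_runs D w)%N /\
  first_run (b :: w) = (first_run w).+1.
Proof.
move=> h; rewrite /long_runs /first_run run_seq_cons h eqxx.
have := run_seq_eq0 w; case: (run_seq w) => [|r rs] /=.
  by case: (w) h.
move=> _; split=> //; rewrite ltnS leq_eqVlt eq_sym.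
by case: eqVneq => [->|_] //=; rewrite ltnn.
Qed.

Definition long_count (D t n : nat) : nat :=
  count (fun w => long_runs D w == n) (words t).

Definition first_run_count (D k t n : nat) : nat :=
  count (fun w => (first_run w == k) && (long_runs D w == n)) (words t).

(** Of the two letters that can precede a nonempty word, one extends its first run and the other
    starts a new run. *)
Lemma count_words_cons (P Q1 Q2 : pred (seq bool)) t :
  (forall b w, size w = t.+1 ->
     P (b :: w) = if ohead w == Some b then Q1 w else Q2 w) ->
  count P (words t.+2) = (count Q1 (words t.+1) + count Q2 (words t.+1))%N.
Proof.
move=> h; rewrite count_wordsS.
have : all (fun w => size w == t.+1) (words t.+1).
  by apply/allP => w; rewrite mem_words.
elim: (words _) => //= w l ih /andP[/eqP sz /ih {}ih].
have : (P (true :: w) + P (false :: w) = Q1 w + Q2 w)%N.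
  by rewrite !h //; case: w sz => // -[] w _ /=; rewrite ?eqxx //= addnC.
by move: ih; lia.
Qed.

Lemma first_run_count_S D k t n : (0 < D)%N -> (0 < k)%N ->
  first_run_count D k.+1 t.+2 n =
  count (fun w => [&& first_run w == k & ((first_run w == D) + long_runs D w)%N == n])
    (words t.+1).
Proof.
move=> D0 k0; rewrite /first_run_count.
rewrite (@count_words_cons _ (fun w => (first_run w == k) &&
  ((first_run w == D) + long_runs D w == n)%N) pred0) ?count_pred0 ?addn0 //.
move=> b w sz; case: (ohead w =P Some b) => [h|/eqP h].
  by have [-> ->] := long_runs_cons_eq D h; rewrite eqSS.
have [-> ->] := long_runs_cons_neq D0 h.
by rewrite eqSS eq_sym -[k == _]negbK -lt0n k0.
Qed.

Lemma first_run_gt0 w : w <> [::] -> (0 < first_run w)%N.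
Proof.
case: w => // b w _; rewrite /first_run run_seq_cons; case: ifP => //= _.
by case: (run_seq w).
Qed.

Lemma first_run_count1 D t n : (0 < D)%N ->
  first_run_count D 1 t.+2 n = long_count D t.+1 n.
Proof.
move=> D0; rewrite /first_run_count.
rewrite (@count_words_cons _ pred0 (fun w => long_runs D w == n)) ?count_pred0 //.
move=> b w sz; case: (ohead w =P Some b) => [h|/eqP h].
  have [_ ->] := long_runs_cons_eq D h.
  have : (0 < first_run w)%N by apply: first_run_gt0 => e; rewrite e in sz.
  by case: (first_run w).
by have [-> ->] := long_runs_cons_neq D0 h.
Qed.

Lemma first_run_countS D k t n : (0 < k < D)%N ->
  first_run_count D k.+1 t.+1 n = first_run_count D k t n.
Proof.
move=> /andP[k0 kD]; case: t => [|t].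
  rewrite /first_run_count /= /first_run /=.
  by rewrite !eqSS ![0%N == k]eq_sym -[k == _]negbK -lt0n k0.
rewrite first_run_count_S //; last exact: leq_ltn_trans kD.
apply: eq_count => w /=; case: eqP => //= ->.
by rewrite (ltn_eqF kD).
Qed.

(* The count of sign words of length t with n runs of length > D, with its value
   at t = 0 doubled so that it is twice a number of compositions for all t. *)
Definition ext_count (D t n : nat) : nat :=
  if t is 0 then (n == 0).*2 else long_count D t n.

(** Deleting the first run, which is not long, leaves a word of length [t]. At [t = 0] nothing is
    left to determine the sign of the run, whence the doubled value of [ext_count]. *)
Lemma first_run_count_add D k t n : (k < D)%N ->
  first_run_count D k.+1 (t + k).+1 n = ext_count D t n.
Proof.
elim: k => [|k ih] kD.
  rewrite addn0; case: t => [|t]; last exact: first_run_count1.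
  rewrite /first_run_count /= /first_run /long_runs /= !addn0 (ltnNge D) kD.
  by case: n => [|n].
by rewrite addnS first_run_countS ?kD // ih // ltnW.
Qed.

Lemma first_run_count_lt D k t n : (t <= k < D)%N -> first_run_count D k.+1 t n = 0%N.
Proof.
elim: k t => [|k ih] t /andP[tk kD].
  by move: tk; rewrite leqn0 => /eqP ->.
case: t tk => [|t] tk; first by rewrite /first_run_count.
by rewrite first_run_countS // ih // -ltnS tk ltnW.
Qed.

(** Prepending either sign keeps the number of long runs, except when it extends a first run of
    length exactly [D], which becomes long. *)
Lemma ext_count_rec D t n : (0 < D)%N -> 
  (ext_count D t.+2 n + first_run_count D D t.+1 n =
   (ext_count D t.+1 n).*2 + (if n is n'.+1 then first_run_count D D t.+1 n' else 0))%N.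
Proof.
move=> D0; rewrite /ext_count /long_count /first_run_count.
rewrite (@count_words_cons _
  (fun w => (first_run w == D) + long_runs D w == n)%N (fun w => long_runs D w == n)).
  elim: (words _) => [|w l] /=; first by case: (n).
  case: n => [|n] /=; case: (first_run w == D) => /=; rewrite ?add0n ?add1n ?eqSS; lia.
move=> b w sz; case: (ohead w =P Some b) => [h|/eqP h].
  by have [-> _] := long_runs_cons_eq D h.
by have [-> _] := long_runs_cons_neq D0 h.
Qed.

Lemma ext_count1 D n : (0 < D)%N -> ext_count D 1 n = ext_count D 0 n.
Proof.
move=> D0; rewrite /ext_count /long_count /= /long_runs /= (ltnNge D) D0 /=.
by case: n.
Qed.

Lemma excursion_count_ext (R : realType) D n t : (0 < t)%N ->
  (excursion_count R D (2 * n) t).*2 = ext_count D t n.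
Proof. by move=> t0; rewrite excursion_count_double //; case: t t0. Qed.

(** * Asymptotics *)

(** Up to the error of [y], the deviation from the limit contracts by the factor [q = b * D] over
    each block of [D] steps. *)
Lemma averaging_cvg (R : realType) (b l : R) (D : nat) (x y : nat -> R) :
  (0 < D)%N -> 0 <= b -> b * D%:R < 1 ->
  (forall k, x (k + D)%N = b * (\sum_(j < D) x (k + j)%N) + y k) ->
  y @ \oo --> l -> x @ \oo --> l / (1 - b * D%:R).
Proof.
move=> D0 b0 q1 xrec yl; set q := b * D%:R in q1 *; set lim := l / (1 - q).
have q0 : 0 <= q by rewrite mulr_ge0.
pose z k := x k - lim; pose e k := y k - l.
have zrec k : z (k + D)%N = b * (\sum_(j < D) z (k + j)%N) + e k.
  rewrite /z /e xrec sumrB sumr_const card_ord mulrBr -[lim *+ D]mulr_natl.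
  have -> : b * (D%:R * lim) = lim - l.
    rewrite mulrA -/q /lim; field; rewrite subr_eq0 gt_eqF //.
  by ring.
apply/cvgrPdist_le => eps eps0.
(* Chosen so that [eps / 2] is reproduced by the recursion: [q * (eps / 2) + eps * (1 - q) / 2 = eps
   / 2]. *)
have d0 : 0 < eps * (1 - q) / 2 by rewrite divr_gt0 // mulr_gt0 // subr_gt0.
have /cvgrPdist_le/(_ _ d0)[K _ hK] := yl.
pose B : R := \sum_(j < D) `|z (K + j)%N|.
have B0 : 0 <= B by apply: sumr_ge0.
have bound m : `|z (K + m)%N| <= eps / 2 + B * q ^+ (m %/ D).
  have [n] := ubnP m; elim: n => // n ih in m *; rewrite ltnS => mn.
  have [mD|Dm] := ltnP m D.
    rewrite divn_small // expr0 mulr1 ler_wpDl //; first by rewrite divr_ge0 // ltW.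
    by rewrite /B (bigD1 (Ordinal mD)) //= ler_wpDr // sumr_ge0.
  have [m' em] : exists m', m = (m' + D)%N by exists (m - D)%N; rewrite subnK.
  rewrite em addnA zrec; apply: le_trans (ler_normD _ _) _.
  have he : `|e (K + m')%N| <= eps * (1 - q) / 2.
    by rewrite distrC; apply: hK; rewrite /= leq_addr.
  have hs : b * `|\sum_(j < D) z (K + m' + j)%N| <=
      b * (D%:R * (eps / 2 + B * q ^+ (m' %/ D))).
    apply: ler_wpM2l => //; apply: le_trans (ler_norm_sum _ _ _) _.
    rewrite mulr_natl -[X in _ *+ X]card_ord -sumr_const; apply: ler_sum => j _.
    rewrite -addnA; apply: le_trans (ih _ _) _.
      by apply: leq_trans mn; rewrite em ltn_add2l.
    rewrite lerD2l ler_wpM2l //; apply: ler_wiXn2l => //; first exact: ltW.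
    by apply: leq_div2r; rewrite leq_addr.
  rewrite normrM (ger0_norm b0); apply: le_trans (lerD hs he) _.
  rewrite divnDr // divnn D0 addn1 exprS mulrA -/q.
  by rewrite le_eqVlt; apply/orP; left; apply/eqP; rewrite /q; field.
have qn : (fun n => B * q ^+ n) @ \oo --> (0 : R).
  by apply: cvg_geometric; rewrite ger0_norm.
have e20 : 0 < eps / 2 by rewrite divr_gt0.
have /cvgrPdist_le/(_ _ e20)[N _ hN] := qn.
(* [K] steps make the error of [y] small, and [N] further blocks of [D] steps the geometric term. *)
exists (K + N * D)%N => // n /= len.
have := bound (n - K)%N; rewrite subnKC; last by apply: leq_trans len; rewrite leq_addr.
rewrite distrC -/(z n) => /le_trans; apply.
rewrite [leRHS]splitr lerD2l.
have := hN ((n - K) %/ D)%N; rewrite /= sub0r normrN ger0_norm ?mulr_ge0 ?exprn_ge0 //.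
by apply; rewrite leq_divRL // leq_subRL 1?addnC //; lia.
Qed.

(** By telescoping, [h n.+1 / n.+1] is the mean of the increments plus [h 0 / n.+1]. *)
Lemma cesaro_slope (R : realType) (h : nat -> R) (l : R) :
  (fun k => h k.+1 - h k) @ \oo --> l -> (fun k => h k / k%:R) @ \oo --> l.
Proof.
move=> /cesaro hl; rewrite -(cvg_shiftS (fun k => h k / k%:R)) /=.
have -> : (fun n => h n.+1 / n.+1%:R) =
    arithmetic_mean (fun k => h k.+1 - h k) \+ (fun n => h 0%N * harmonic n).
  apply/funext => n; rewrite /arithmetic_mean /harmonic /=.
  rewrite -/(telescope h) telescopeK /=.
  by ring.
have -> : l = l + h 0%N * 0 by ring.
apply: cvgD => //.
by apply: cvgMr; exact: cvg_harmonic.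
Qed.

Section LinearRecurrence.
Variables (R : realType) (b : R) (D : nat).
Hypotheses (D0 : (0 < D)%N) (b0 : 0 <= b) (bD : b * D%:R < 1).

(** The quantity [x (k + D) - b * (x k + ... + x (k + D - 1))] does not depend on [k], so
    [averaging_cvg] applies with constant forcing. *)
Lemma recurrence_cvg (x : nat -> R) :
  (forall k, x (k + D).+1 = (1 + b) * x (k + D)%N - b * x k) ->
  x @ \oo --> (x D - b * \sum_(j < D) x j) / (1 - b * D%:R).
Proof.
move=> xrec.
apply: (@averaging_cvg _ _ _ _ x (fun=> x D - b * \sum_(j < D) x j)) => //;
  last exact: cvg_cst.
elim=> [|k ih].
  by rewrite add0n; under [X in _ * X + _]eq_bigr do rewrite add0n; ring.
rewrite addSn xrec ih.
have shift : \sum_(j < D) x (k.+1 + j)%N + x k =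
             \sum_(j < D) x (k + j)%N + x (k + D)%N.
  transitivity (\sum_(j < D.+1) x (k + j)%N); last by rewrite big_ord_recr.
  rewrite big_ord_recl addn0 addrC; congr (_ + _).
  by apply: eq_bigr => j _; rewrite addSnnS.
have -> : \sum_(j < D) x (k.+1 + j)%N =
          \sum_(j < D) x (k + j)%N + x (k + D)%N - x k by rewrite -shift addrK.
by rewrite ih; ring.
Qed.

Lemma forced_recurrence_slope (x y : nat -> R) (l : R) :
  (forall k, y (k + D).+1 = (1 + b) * y (k + D)%N - b * y k + b * x k) ->
  x @ \oo --> l ->
  (fun k => y k.+1 - y k) @ \oo --> b * l / (1 - b * D%:R).
Proof.
move=> yrec xl.
apply: (@averaging_cvg _ _ _ _ _ (fun k => b * x k)) => //; last exact: cvgMr.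
move=> k; rewrite yrec.
have -> : \sum_(j < D) (y (k + j).+1 - y (k + j)%N) = y (k + D)%N - y k.
  rewrite -(big_mkord xpredT (fun j => y (k + j).+1 - y (k + j)%N)).
  under eq_bigr do rewrite -addnS.
  by rewrite (telescope_sumr (fun j => y (k + j)%N)) // addn0.
ring.
Qed.

End LinearRecurrence.

(** * The positive root of [alpha_poly] *)

Section Alpha.
Variables (R : realType) (D : nat).
Hypothesis D2 : (2 <= D)%N.
Implicit Types z : R.

Lemma root_alpha_poly z : root (alpha_poly R D) z = (z ^+ D == \sum_(i < D) z ^+ i).
Proof.
rewrite rootE /alpha_poly hornerD hornerN hornerXn horner_sum subr_eq0.
by congr (_ == _); apply: eq_bigr => i _; rewrite hornerXn.
Qed.

Lemma alpha_root_gt1 z : 0 < z -> root (alpha_poly R D) z -> 1 < z.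
Proof.
move=> z0; rewrite root_alpha_poly => /eqP e; rewrite ltNge; apply/negP => z1.
case: D D2 e => [|[|d]] // _; rewrite big_ord_recl big_ord_recl /= expr0 expr1.
have : z ^+ d.+2 <= 1 by rewrite exprn_ile1 // ltW.
have : 0 <= \sum_(i < d) z ^+ lift ord0 (lift ord0 i).
  by apply: sumr_ge0 => i _; rewrite exprn_ge0 // ltW.
by lra.
Qed.

(** Multiplying the equation by [z - 1] collapses the geometric sum. *)
Lemma alpha_rootE z : root (alpha_poly R D) z -> z ^+ D * (2 - z) = 1.
Proof.
rewrite root_alpha_poly => /eqP e; have := subrX1 z D.
by rewrite -e => h; move: h; set w := z ^+ D => h; lra.
Qed.

(** The quotient of the sum of the [z ^+ i], [i < D], by [z ^+ D] strictly decreases in [z > 0];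
    this is used in cross-multiplied form. *)
Lemma alpha_root_unique x y : 0 < x -> 0 < y ->
  root (alpha_poly R D) x -> root (alpha_poly R D) y -> x = y.
Proof.
have le u v : 0 < u -> 0 < v -> root (alpha_poly R D) u ->
    root (alpha_poly R D) v -> u <= v.
  move=> u0 v0; rewrite !root_alpha_poly => /eqP eu /eqP ev.
  rewrite leNgt; apply/negP => vu.
  have : v ^+ D * (\sum_(i < D) u ^+ i) < u ^+ D * \sum_(i < D) v ^+ i.
    rewrite !mulr_sumr; apply: ltr_sum => [|i _].
      by apply/hasP; exists (Ordinal (ltnW D2)); rewrite ?mem_index_enum.
    have expD w : w ^+ D = w ^+ (D - i) * w ^+ i :> R.
      by rewrite -exprD subnK // ltnW.
    rewrite !expD -!mulrA [u ^+ i * v ^+ i]mulrC.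
    rewrite ltr_pM2r ?mulr_gt0 ?exprn_gt0 //.
    by rewrite ltrXn2r ?ltW // -lt0n subn_gt0.
  by rewrite -eu -ev mulrC ltxx.
by move=> x0 y0 rx ry; apply/eqP; rewrite eq_le !le.
Qed.

Lemma is_alpha_exists : exists alpha : R, is_alpha D alpha.
Proof.
have sum2 : \sum_(i < D) (2 : R) ^+ i = 2 ^+ D - 1 by rewrite subrX1; ring.
have polyE u : (alpha_poly R D).[u] = u ^+ D - \sum_(i < D) u ^+ i.
  rewrite /alpha_poly hornerD hornerN hornerXn horner_sum.
  by congr (_ - _); apply: eq_bigr => i _; rewrite hornerXn.
have sgn : (alpha_poly R D).[1] <= 0 <= (alpha_poly R D).[2].
  rewrite !polyE sum2 expr1n subKr ler01 andbT.
  rewrite (eq_bigr (fun=> 1)) => [|i _]; last exact: expr1n.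
  by rewrite sumr_const card_ord subr_le0 ler1n ltnW.
have le12 : (1 : R) <= 2 by rewrite ler1n.
have [z /andP[z1 _] rz] := poly_ivt le12 sgn.
have z0 : 0 < z by apply: lt_le_trans z1.
exists z; split=> // y [y0 ry]; exact: alpha_root_unique.
Qed.

End Alpha.

(** [ext_count] delayed by [D.-1] and preceded by zeros, so that the recurrence holds from [k = 0]
    on. *)
Definition padded (D n k : nat) : nat :=
  if (k.+1 < D)%N then 0%N else ext_count D (k.+1 - D) n.

Lemma paddedE D n t : (0 < D)%N -> padded D n (t + D.-1) = ext_count D t n.
Proof.
move=> D0; rewrite /padded -addnS prednK // ltnNge leq_addl /=.
by rewrite addnK.
Qed.

Lemma padded_first_run D n k : (0 < D)%N -> padded D n k = first_run_count D D k.+1 n.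
Proof.
move=> D0; rewrite /padded; case: ltnP => kD.
  rewrite -[in X in _ = first_run_count _ X _ _](prednK D0).
  by rewrite first_run_count_lt //; lia.
have := @first_run_count_add D D.-1 (k.+1 - D) n.
have -> : ((k.+1 - D + D.-1).+1 = k.+1)%N by lia.
by rewrite prednK // => ->.
Qed.

Lemma padded_rec D n k : (0 < D)%N ->
  (padded D n (k + D).+1 + padded D n k =
   (padded D n (k + D)).*2 + (if n is n'.+1 then padded D n' k else 0))%N.
Proof.
move=> D0; have := ext_count_rec k n D0.
rewrite -!(@paddedE D n _ D0) -padded_first_run //.
have -> : (k.+2 + D.-1 = (k + D).+1)%N by lia.
have -> : (k.+1 + D.-1 = k + D)%N by lia.
by case: n => // n; rewrite -padded_first_run.
Qed.

(** For [D = 1] the recurrence says that the second difference in [t] at [n] is the sequence at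
    [n - 1]; Pascal's rule applied twice gives the same for the binomials. *)
Lemma ext_count_binomial t n : ext_count 1 t n = ('C(t, 2 * n)).*2.
Proof.
suff : ext_count 1 t n = ('C(t, 2 * n)).*2 /\ ext_count 1 t.+1 n = ('C(t.+1, 2 * n)).*2.
  by case.
elim: t n => [|t ih] n.
  by rewrite ext_count1 //; case: n => [|n]; rewrite ?muln0 ?mulnS.
have [ih0 ih1] := ih n; split=> //.
have := @padded_rec 1 n t isT.
have pE m k : padded 1 m k = ext_count 1 k m by rewrite -(@paddedE 1) // addn0.
rewrite !pE addn1 ih0 ih1; case: n {ih0 ih1} => [|n].
  by rewrite muln0 !bin0; lia.
by rewrite pE; have [-> _] := ih n; rewrite mulnS add2n !binS; lia.
Qed.

Lemma bin_asymptotics (R : realType) (m : nat) :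
  (fun t : nat => 'C(t, m)%:R / t%:R ^+ m : R) @ \oo --> (m`!%:R^-1 : R).
Proof.
have ffact_cvg : (fun t : nat => (t ^_ m)%:R / t%:R ^+ m : R) @ \oo --> (1 : R).
  elim: m => [|m ih].
    under eq_fun do rewrite ffactn0 expr0 divr1; exact: cvg_cst.
  have ratio : (fun t : nat => (t - m)%:R / t%:R : R) @ \oo --> (1 : R).
    rewrite -(cvg_shiftS (fun t : nat => (t - m)%:R / t%:R : R)).
    have : (fun t : nat => 1 - m%:R * harmonic t : R) @ \oo --> (1 - m%:R * 0 : R).
      by apply: cvgB; [exact: cvg_cst | apply: cvgMr; exact: cvg_harmonic].
    rewrite mulr0 subr0.
    apply: cvg_trans; apply: near_eq_cvg; exists m => // t /= mt.
    by rewrite natrB ?(leq_trans mt) // mulrBl divff // pnatr_eq0.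
  have -> : (fun t : nat => (t ^_ m.+1)%:R / t%:R ^+ m.+1 : R) =
      (fun t : nat => (t ^_ m)%:R / t%:R ^+ m) \* (fun t : nat => (t - m)%:R / t%:R).
    by apply/funext => t /=; rewrite ffactnSr natrM exprSr invfM mulrACA.
  by have := cvgM ih ratio; rewrite mulr1; exact.
have -> : (fun t : nat => 'C(t, m)%:R / t%:R ^+ m : R) =
    (fun t : nat => (t ^_ m)%:R / t%:R ^+ m * m`!%:R^-1).
  by apply/funext => t; rewrite -bin_ffact natrM [RHS]mulrAC mulfK.
have : (fun t : nat => (t ^_ m)%:R / t%:R ^+ m * m`!%:R^-1 : R) @ \oo -->
    (1 * m`!%:R^-1 : R) by exact: cvgMl.
by rewrite mul1r.
Qed.

(** * Counts normalized by the growth rate *)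

Section AlphaCounts.
Variables (R : realType) (D : nat) (alpha : R).
Hypotheses (D2 : (2 <= D)%N) (isa : is_alpha D alpha).

Let D0 : (0 < D)%N. Proof. exact: ltnW. Qed.
Let ra : root (alpha_poly R D) alpha. Proof. by case: isa => -[]. Qed.
Let a1 : 1 < alpha. Proof. by case: isa => -[a0 _] _; exact: alpha_root_gt1 a0 ra. Qed.
Let a0 : 0 < alpha. Proof. exact: lt_trans a1. Qed.
Let aN0 : alpha != 0. Proof. by rewrite gt_eqF. Qed.
Let aD : alpha ^+ D * (2 - alpha) = 1. Proof. exact: alpha_rootE ra. Qed.

Let beta : R := alpha ^- D.+1.

Let betaE : 1 + beta = 2 / alpha.
Proof.
have e : alpha ^- D = 2 - alpha.
  by apply: (mulfI (expf_neq0 D aN0)); rewrite aD mulfV // expf_neq0.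
by rewrite /beta exprSr invfM e; field.
Qed.

Let beta_ge0 : 0 <= beta. Proof. by rewrite invr_ge0 exprn_ge0 // ltW. Qed.

(** [alpha ^+ D] is a sum of [D] powers, each at least 1, so [D <= alpha ^+ D < alpha ^+ D.+1]. *)
Let betaD : beta * D%:R < 1.
Proof.
rewrite mulrC ltr_pdivrMr ?exprn_gt0 // mul1r.
have h : D%:R <= alpha ^+ D.
  have := ra; rewrite root_alpha_poly => /eqP ->.
  rewrite -[X in X%:R <= _]card_ord -sumr_const; apply: ler_sum => i _.
  by rewrite exprn_ege1 // ltW.
by apply: le_lt_trans h _; rewrite exprS ltr_pMl // exprn_gt0.
Qed.

Definition normalized (n k : nat) : R := (padded D n k)%:R / 2 / alpha ^+ k.

Lemma normalized_rec n k : normalized n (k + D).+1 =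
  (1 + beta) * normalized n (k + D) - beta * normalized n k +
  (if n is n'.+1 then beta * normalized n' k else 0).
Proof.
have := congr1 (fun m : nat => m%:R : R) (@padded_rec D n k D0).
rewrite -!muln2 !natrD natrM /normalized betaE /beta => h.
have eqD : (padded D n (k + D).+1)%:R = (padded D n (k + D))%:R * 2 +
  (if n is n'.+1 then padded D n' k else 0)%:R - (padded D n k)%:R :> R.
  by rewrite -h addrK.
rewrite eqD; have aDN0 := expf_neq0 D aN0; have akN0 := expf_neq0 k aN0.
case: n {h eqD} => [|n] /=; rewrite !exprS exprD.
all: by field; apply/and3P; split.
Qed.

Lemma normalized0_cvg :
  normalized 0 @ \oo --> alpha ^- D * (1 - beta * alpha) / (1 - beta * D%:R).
Proof.
have rec k : normalized 0 (k + D).+1 =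
    (1 + beta) * normalized 0 (k + D) - beta * normalized 0 k.
  by rewrite normalized_rec addr0.
have := recurrence_cvg D0 beta_ge0 betaD rec.
suff -> : normalized 0 D - beta * \sum_(j < D) normalized 0 j =
  alpha ^- D * (1 - beta * alpha) by [].
(* Only the index [D.-1] contributes: the padding is zero before it, and there the count is
   [ext_count D 0 0 = 2]. *)
have -> : \sum_(j < D) normalized 0 j = alpha ^- D.-1.
  rewrite -(prednK D0) big_ord_recr /= big1 ?add0r => [|i _].
    rewrite /normalized -[X in padded _ _ X]add0n paddedE // /=.
    by rewrite divff ?pnatr_eq0 // mul1r.
  by rewrite /normalized /padded -[X in (_ < X)%N](prednK D0) ltnS ltn_ord !mul0r.
have -> : normalized 0 D = alpha ^- D.
  rewrite /normalized; have -> : padded D 0 D = 2.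
    by rewrite -[X in padded _ _ X](prednK D0) -add1n paddedE // ext_count1.
  by rewrite divff ?pnatr_eq0 // mul1r.
have -> : alpha ^- D.-1 = alpha * alpha ^- D.
  by rewrite -[in RHS](prednK D0) exprS invfM mulrA mulfV // mul1r.
by ring.
Qed.

Lemma ext_count1_cvg :
  (fun t : nat => (ext_count D t 1)%:R / 2 / (t%:R * alpha ^+ t) : R) @ \oo -->
  d_coef D alpha ^+ 2 / (alpha ^+ D * (alpha - 1)).
Proof.
pose L := alpha ^- D * (1 - beta * alpha) / (1 - beta * D%:R).
pose h t := normalized 1 (t + D.-1).
have hl : (fun k => h k.+1 - h k) @ \oo --> beta * L / (1 - beta * D%:R).
  have := forced_recurrence_slope D0 beta_ge0 betaD (normalized_rec 1) normalized0_cvg.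
  by rewrite -(cvg_shiftn D.-1).
have : (fun k => h k / k%:R * alpha ^+ D.-1) @ \oo -->
    (beta * L / (1 - beta * D%:R) * alpha ^+ D.-1 : R).
  by apply: cvgMl; exact: cesaro_slope.
(* The factor [alpha ^+ D.-1] undoes the delay in [padded]. Replacing [alpha ^+ D] by
   [(2 - alpha)^-1] makes the identity rational in [alpha] and [D]. *)
have -> : beta * L / (1 - beta * D%:R) * alpha ^+ D.-1 =
    d_coef D alpha ^+ 2 / (alpha ^+ D * (alpha - 1)).
  have a2 : 2 - alpha != 0.
    by apply: contra_eq_neq aD => ->; rewrite mulr0 eq_sym oner_neq0.
  have eD : alpha ^+ D = (2 - alpha)^-1 by apply: (mulIf a2); rewrite aD mulVf.
  have eD1 : alpha ^+ D.-1 = ((2 - alpha) * alpha)^-1.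
    by apply: (mulIf aN0); rewrite -exprSr prednK // eD invfM mulfVK.
  have eb : beta = (2 - alpha) / alpha by rewrite -[LHS](addKr 1) betaE; field.
  have den : alpha - (2 - alpha) * D%:R != 0.
    have := betaD; rewrite eb mulrAC ltr_pdivrMr // mul1r => lt.
    by rewrite subr_eq0 gt_eqF.
  have den' : 1 - beta * D%:R != 0 by rewrite subr_eq0 gt_eqF ?betaD.
  rewrite /d_coef /L eD eD1; move: den'; rewrite eb => den'.
  have aN1 : alpha - 1 != 0 by rewrite subr_eq0 gt_eqF.
  have den2 : 2 + (D%:R + 1) * (alpha - 2) = alpha - (2 - alpha) * D%:R by ring.
  by field; rewrite a2 aN1 den2 den aN0.
suff -> : (fun k => h k / k%:R * alpha ^+ D.-1) =
  (fun t : nat => (ext_count D t 1)%:R / 2 / (t%:R * alpha ^+ t)) by [].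
apply/funext => t; rewrite /h /normalized paddedE // exprD.
rewrite !invfM; set u := alpha ^+ D.-1; have u0 : u != 0 by rewrite expf_neq0.
by rewrite -[RHS]mulr1 -(mulVf u0); ring.
Qed.

End AlphaCounts.

Theorem theorem1p1 (R : realType) :
  (forall n : nat,
     ((excursion_count R 1 (2 * n) t)%:R / t%:R ^+ (2 * n) : R)
       @[t --> \oo] --> (((2 * n)`!)%:R^-1 : R))
  /\
  (forall D : nat, (2 <= D)%N ->
     exists2 alpha : R, is_alpha D alpha &
       ((excursion_count R D 2 t)%:R / (t%:R * alpha ^+ t) : R)
         @[t --> \oo] --> (d_coef D alpha ^+ 2 / (alpha ^+ D * (alpha - 1)) : R)).
Proof.
split=> [n|D D2].
  (* The sequences are compared along [t.+1], since [excursion_count_ext] is stated for positive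
     lengths. *)
  have := @bin_asymptotics R (2 * n); rewrite -cvg_shiftS => h.
  rewrite -cvg_shiftS /=; apply: cvg_trans h; apply: near_eq_cvg.
  apply: nearW => t /=; congr (_%:R / _).
  by apply: double_inj; rewrite excursion_count_ext // ext_count_binomial.
have [alpha isa] := @is_alpha_exists R D D2; exists alpha => //.
have := ext_count1_cvg D2 isa; rewrite -cvg_shiftS => h.
rewrite -cvg_shiftS /=; apply: cvg_trans h; apply: near_eq_cvg.
apply: nearW => t; congr (_ / _).
have /(congr1 (fun m : nat => m%:R : R)) := excursion_count_ext R D 1 (ltn0Sn t).
by rewrite -muln2 natrM => <-; rewrite mulfK // pnatr_eq0.
Qed.
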